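(* Let $(S,0)$ be an analytically irreducible quasi-ordinary hypersurface germ of dimension $d\ge 1$ with characteristic exponents $\lambda_1\prec\cdots\prec\lambda_g$ and associated semigroup $\Gamma$, and consider an overweight deformation $H_1,\dots,H_g$ of the binomials $h_1,\dots,h_g$ defining $Z^\Gamma$, with fibers $(S_p,0)\subset(\mathbb{C}^{d+g},0)$. Then for any point $p$ in the torus of $Z^\Gamma$ we have $$X^{\gamma_0}\,\mathcal{J}_{\mathrm{log}}(S_p)\subset \mathrm{Jac}(S_p)\,\mathcal{O}_Z .$$
   Context: Quasi-ordinary data. Let $d\ge 1$, $X=(X_1,\dots,X_d)$. A Weierstrass polynomial $f\in\mathbb{C}\{X\}[Y]$ is quasi-ordinary if its discriminant with respect to $Y$ is $X^\delta\epsilon$ with $\delta\in\mathbb{Z}_{\ge0}^d$ and $\epsilon$ a unit of $\mathbb{C}\{X\}$. Let $f$ be irreducible quasi-ordinary of degree $n$, defining $(S,0)\subset(\mathbb{C}^{d+1},0)$. Its roots lie in $\mathbb{C}\{X_1^{1/n},\dots,X_d^{1/n}\}$ (Jung-Abhyankar) and are called quasi-ordinary branches; they parametrize $S$. The difference of two distinct roots is $X^{\lambda}$ times a unit; the exponents $\lambda\in\frac1n\mathbb{Z}_{\ge0}^d$ so obtained are the characteristic exponents, and (Lipman) they can be labelled $\lambda_1\prec\cdots\prec\lambda_g$, where $\gamma\prec\gamma'$ means $\gamma'-\gamma\in\mathbb{R}^d_{\ge0}$ and $\gamma\ne\gamma'$. Let $e_1,\dots,e_d$ be the canonical basis of $M_0=\mathbb{Z}^d$,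 $M_j=M_{j-1}+\mathbb{Z}\lambda_j$, $M=M_g$, $n_j=[M_j:M_{j-1}]$, $\sigma^\vee=\mathbb{R}^d_{\ge0}$. Put $\overline\lambda_1=\lambda_1$, $\overline\lambda_{j+1}=n_j\overline\lambda_j+\lambda_{j+1}-\lambda_j$. $\Gamma\subset\sigma^\vee\cap M$ is the semigroup generated by $\gamma_1,\dots,\gamma_{d+g}:=e_1,\dots,e_d,\overline\lambda_1,\dots,\overline\lambda_g$. There are uniquely determined relations $n_j\overline\lambda_j=\sum_{i=1}^{d}\ell_i^{(j)}e_i+\sum_{k=1}^{j-1}\ell_{d+k}^{(j)}\overline\lambda_k$ with $\ell_i^{(j)}\in\mathbb{Z}_{\ge0}$ for $i\le d$ and $0\le \ell_{d+k}^{(j)}<n_k$, $j=1,\dots,g$. Put $\gamma_0=\sum_{j=1}^g(n_j-1)\overline\lambda_j-\sum_{i=1}^d e_i$ (the minimal Frobenius vector of $\Gamma$). Deformation. Let $h_j=U_1^{\ell_1^{(j)}}\cdots U_{d+j-1}^{\ell_{d+j-1}^{(j)}}-U_{d+j}^{n_j}$, $j=1,\dots,g$; these generate the ideal of $Z^\Gamma=\mathrm{Spec}\,\mathbb{C}[\Gamma]\subset\mathbb{C}^{d+g}$, $U_i=X^{\gamma_i}$. Let $\psi:\mathbb{Z}^{d+g}\to M$ send the $i$th canonical vector to $\gamma_i$. An overweight deformation is a family $$H_j=h_j+c_j\,t^{\overline\lambda_{j+1}-n_j\overline\lambda_j}U_{d+j+1}+\sum_{n_j\overline\lambda_j\prec\psi(\alpha^{(j)})}c_{\alpha^{(j)}}\,t^{\psi(\alpha^{(j)})-n_j\overline\lambda_j}\,U_1^{\alpha_1^{(j)}}\cdots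 U_{d+j}^{\alpha_{d+j}^{(j)}},\quad j=1,\dots,g,$$ with $\alpha^{(j)}\in\mathbb{Z}_{\ge0}^{d+j}$ (viewed in $\mathbb{Z}^{d+g}$), $c_{\alpha^{(j)}}\in\mathbb{C}$, $c_j\in\mathbb{C}^*$ for $j<g$, and $c_g=0$. A point $p$ of the torus of $Z^\Gamma$ is a group homomorphism $M\to\mathbb{C}^*$, $m\mapsto t^m(p)$; $H_{j,p}$ is obtained by replacing each $t^m$ by $t^m(p)$ and is assumed convergent. $S_p$ is the germ at $0$ of $H_{1,p}=\dots=H_{g,p}=0$. For $p$ in the torus, eliminating $U_{d+g},\dots,U_{d+2}$ embeds $S_p$ as an irreducible quasi-ordinary hypersurface in $(\mathbb{C}^{d+1},0)$ with coordinates $(U_1,\dots,U_{d+1})$, parametrized by a quasi-ordinary branch $U_{d+1}=\zeta_p(X)$, $U_i=X_i$ $(i\le d)$, with characteristic exponents $\lambda_1,\dots,\lambda_g$; the integral closure of $\mathcal{O}_{S_p}$ is $\mathcal{O}_Z=\mathbb{C}\{\sigma^\vee\cap M\}$, the ring of convergent power series in $X$ with exponents in $\sigma^\vee\cap M$, via $U_i\mapsto X^{e_i}$ $(i\le d)$, $U_{d+1}\mapsto\zeta_p$. $\mathrm{Jac}(S_p)\subset\mathcal{O}_{S_p}$ is the ideal generated by the $g\times g$ minors of $(\partial H_{j,p}/\partial U_i)$, and $\mathrm{Jac}(S_p)\mathcal{O}_Z$ is its extension. Logarithmic Jacobian ideal. For an analytically irreducible germ $W$ of dimension $d$ whose normalization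 is $Z$ (local ring $\mathcal{O}_Z=\mathbb{C}\{\sigma^\vee\cap M\}$), let $\Omega^1_W$ be the module of (analytic) Kähler differentials and $\Omega^d_W=\bigwedge^d\Omega_W^1$. Let $\eta:\Omega^1_Z\to\mathcal{O}_Z\otimes_{\mathbb{Z}}M$ be the $\mathcal{O}_Z$-linear map with $d(\sum c_\gamma X^\gamma)\mapsto\sum c_\gamma X^\gamma\otimes\gamma$. With $\bigwedge^dM\cong\mathbb{Z}$ (choice of a basis of $M$), $\mathcal{J}_{\mathrm{log}}(W)$ (also written $\mathcal{J}_{\mathrm{log}}(W)\mathcal{O}_Z$) is the ideal of $\mathcal{O}_Z$ generated by the image of $\Omega^d_W\to\Omega^d_Z\xrightarrow{\wedge^d\eta}\mathcal{O}_Z\otimes\bigwedge^dM\cong\mathcal{O}_Z$. The product of $X^{\gamma_0}$ with an ideal is taken in the fraction field of $\mathcal{O}_Z$. *)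

(* Defs.v *)
From HB Require Import structures.
From mathcomp Require Import all_boot all_order all_algebra.
From mathcomp Require Import fraction.
From mathcomp Require Import boolp classical_sets reals.
From mathcomp Require Import complex.
From mathcomp Require Import mpoly.

Set Implicit Arguments.
Unset Strict Implicit.
Unset Printing Implicit Defensive.

Import Order.TTheory GRing.Theory Num.Theory.
Local Open Scope ring_scope.

Record fps (K : fieldType) (k : nat) := Fps { coefs :> 'X_{1..k} -> K }.

Section FpsRing.
Variables (K : fieldType) (k : nat).
Implicit Types (f g h : fps K k) (m : 'X_{1..k}).

HB.instance Definition _ := gen_eqMixin (fps K k).
HB.instance Definition _ := gen_choiceMixin (fps K k).

Lemma fpsP f g : (forall m, f m = g m) -> f = g.
Proof. by case: f g => f [g] /= /funext ->. Qed.

Definition fps0 := Fps (fun _ : 'X_{1..k} => 0 : K).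
Definition fps1 := Fps (fun m : 'X_{1..k} => (m == 0%MM)%:R : K).
Definition fps_add f g := Fps (fun m => f m + g m).
Definition fps_opp f := Fps (fun m => - f m).
Definition fps_mul f g :=
  Fps (fun m => \sum_(h : 'X_{1..k < (mdeg m).+1} | (h <= m)%MM)
                  f h * g (m - h)%MM).

Lemma fps_addA : associative fps_add.
Proof. by move=> f g h; apply: fpsP => m /=; rewrite addrA. Qed.

Lemma fps_addC : commutative fps_add.
Proof. by move=> f g; apply: fpsP => m /=; rewrite addrC. Qed.

Lemma fps_add0 : left_id fps0 fps_add.
Proof. by move=> f; apply: fpsP => m /=; rewrite add0r. Qed.

Lemma fps_addN : left_inverse fps0 fps_opp fps_add.
Proof. by move=> f; apply: fpsP => m /=; rewrite addNr. Qed.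

HB.instance Definition _ :=
  GRing.isZmodule.Build (fps K k) fps_addA fps_addC fps_add0 fps_addN.

(* A coefficient of a product only depends on truncations, which are
   polynomials: the ring axioms are inherited from [{mpoly K[k]}]. *)
Definition fps_trunc (b : nat) f : {mpoly K[k]} :=
  \sum_(m : 'X_{1..k < b}) f m *: 'X_[m].

Lemma fps_truncE b f m : (mdeg m < b)%N -> (fps_trunc b f)@_m = f m.
Proof. exact: mcoeff_mpoly. Qed.

Lemma mcoeffM_le (p q p' q' : {mpoly K[k]}) m :
    (forall a, (mdeg a <= mdeg m)%N -> p@_a = p'@_a) ->
    (forall a, (mdeg a <= mdeg m)%N -> q@_a = q'@_a) ->
  (p * q)@_m = (p' * q')@_m.
Proof.
move=> pp' qq'; rewrite !mcoeffM; apply: eq_bigr => h _.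
by rewrite pp' ?qq' // -ltnS bmdeg.
Qed.

Lemma fps_mulE b f g m : (mdeg m < b)%N ->
  fps_mul f g m = (fps_trunc b f * fps_trunc b g)@_m.
Proof.
move=> mb; rewrite [RHS](@mcoeff_poly_mul_lin _ _ _ _ m (mdeg m).+1) //=.
apply: eq_bigr => h lehm; rewrite !fps_truncE //.
  by rewrite (leq_ltn_trans (mdegB _ _)).
by rewrite (leq_trans (bmdeg h)).
Qed.

Lemma fps_mulA : associative fps_mul.
Proof.
move=> f g h; apply: fpsP => m; pose b := (mdeg m).+1.
rewrite !(fps_mulE (b := b)) //.
transitivity ((fps_trunc b f * (fps_trunc b g * fps_trunc b h))@_m).
  by apply: mcoeffM_le => // a am; rewrite fps_truncE // (fps_mulE (b := b)).
rewrite mulrA.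
by apply: mcoeffM_le => // a am; rewrite fps_truncE // (fps_mulE (b := b)).
Qed.

Lemma fps_mulC : commutative fps_mul.
Proof.
move=> f g; apply: fpsP => m.
by rewrite !(fps_mulE (b := (mdeg m).+1)) // mulrC.
Qed.

Lemma fps_mul1 : left_id fps1 fps_mul.
Proof.
move=> f; apply: fpsP => m; rewrite (fps_mulE (b := (mdeg m).+1)) //.
rewrite -[in RHS](@fps_truncE (mdeg m).+1) // -[in RHS](mul1r (fps_trunc _ f)).
by apply: mcoeffM_le => // a am; rewrite fps_truncE // mcoeff1.
Qed.

Lemma fps_mulDl : left_distributive fps_mul +%R.
Proof.
move=> f g h; apply: fpsP => m /=; rewrite -big_split /=.
by apply: eq_bigr => a _; rewrite mulrDl.
Qed.

Lemma fps1_neq0 : fps1 != 0.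
Proof.
apply/eqP => /(congr1 (fun f : fps K k => f 0%MM)) /=.
by rewrite eqxx => /eqP; rewrite oner_eq0.
Qed.

HB.instance Definition _ := GRing.Zmodule_isComNzRing.Build (fps K k)
  fps_mulA fps_mulC fps_mul1 fps_mulDl fps1_neq0.

Definition fps_unit : {pred fps K k} := fun f => `[< exists g, g * f = 1 >].

Definition fps_inv f : fps K k :=
  match pselect (exists g, g * f = 1) with
  | left fU => projT1 (cid fU)
  | right _ => f
  end.

Lemma fps_mulVx : {in fps_unit, left_inverse 1 fps_inv *%R}.
Proof.
move=> f; rewrite unfold_in => /asboolP fU; rewrite /fps_inv.
by case: pselect => // fU'; case: cid.
Qed.

Lemma fps_unitPl f g : g * f = 1 -> fps_unit f.
Proof. by move=> gf1; apply/asboolP; exists g. Qed.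

Lemma fps_invr_out : {in [predC fps_unit], fps_inv =1 id}.
Proof.
move=> f; rewrite inE /= unfold_in => /asboolP fU; rewrite /fps_inv.
by case: pselect.
Qed.

HB.instance Definition _ := GRing.ComNzRing_hasMulInverse.Build (fps K k)
  fps_mulVx fps_unitPl fps_invr_out.

Lemma fps_lead f : f != 0 ->
  exists2 m, f m != 0 & forall a : 'X_{1..k}, (a < m)%O -> f a = 0.
Proof.
move=> f0; apply: contrapT => nolead; case/eqP: f0; apply: fpsP.
apply: ltmwf => m IHm; apply: contrapT => /eqP fm0.
by apply: nolead; exists m.
Qed.

Lemma fps_integral : GRing.integral_domain_axiom (fps K k).
Proof.
move=> f g fg0; apply: contrapT => /negP; rewrite negb_or.
case/andP => /fps_lead[a fa0 amin] /fps_lead[b gb0 bmin].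
move/(congr1 (fun f : fps K k => f (a + b)%MM)): fg0; apply/eqP => /=.
have ltab : (mdeg a < (mdeg (a + b)).+1)%N by rewrite ltnS mdegD leq_addr.
rewrite (bigD1 (BMultinom ltab)) /=; last exact: lem_addr.
have -> : (a + b - a)%MM = b by rewrite [(a + b)%MM]addmC addmK.
rewrite big1 ?addr0 ?mulf_neq0 // => h /andP[]; rewrite bmeqP /=.
move: (bmnm h) => c cab cna; case: (ltgtP c a) cna => // [ltca|ltac] _.
  by rewrite amin // mul0r.
rewrite [X in _ * X]bmin ?mulr0 //.
by rewrite -(ltmc_add2l _ _ c) submK // addmC ltmc_add2r.
Qed.

HB.instance Definition _ :=
  GRing.ComUnitRing_isIntegral.Build (fps K k) fps_integral.

Definition fps_mon (c : K) (m : 'X_{1..k}) : fps K k :=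
  Fps (fun a => c *+ (a == m)).

Definition fps_deriv (i : 'I_k) f : fps K k :=
  Fps (fun a => f (a + U_(i))%MM *+ (a i).+1).

End FpsRing.

(* [F(z_1, ..., z_k)], meaningful when all [z_i] have zero constant term: then
   [z^a] has no coefficient at [b] as soon as [mdeg a > mdeg b], so that the sum
   below has all the nonzero contributions. *)
Definition fps_eval (K : fieldType) (k d : nat)
    (F : fps K k) (z : 'I_k -> fps K d) : fps K d :=
  Fps (fun b => \sum_(a : 'X_{1..k < (mdeg b).+1})
                  F a * (\prod_(i < k) z i ^+ a i) b).

Definition unit_in (S : pzRingType) (A : set S) : set S :=
  [set u | A u /\ exists2 v, A v & u * v = 1].

Definition irreducible_in (S : pzRingType) (A : set S) (f : S) : Prop :=
  [/\ A f, ~ unit_in A f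
    & forall g h, A g -> A h -> f = g * h -> unit_in A g \/ unit_in A h].

Definition ideal_gen (S : pzRingType) (A G : set S) : set S :=
  [set x | exists (m : nat) (a s : 'I_m -> S),
     (forall i, A (a i) /\ G (s i)) /\ x = \sum_(i < m) a i * s i].

Definition discriminant (S : nzRingType) (f : {poly S}) : S :=
  (-1) ^+ 'C((size f).-1, 2) * resultant f f^`().

(* [m] is the cardinality of [G / H]: [r] lists representatives of the
   cosets, each coset being represented exactly once. *)
Definition is_index (V : zmodType) (G H : set V) (m : nat) : Prop :=
  exists r : 'I_m -> V, (forall i, G (r i)) /\
    forall x, G x -> exists! i : 'I_m, H (x - r i).

Section Exponents.
Variable d : nat.
Implicit Types (x y : 'rV[rat]_d) (lam : seq 'rV[rat]_d) (nn : seq nat).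

Definition preceq x y : Prop := forall i, x 0 i <= y 0 i.
Definition prec x y : Prop := preceq x y /\ x != y.

Definition int_lattice : set 'rV[rat]_d :=
  [set map_mx intr a | a in [set: 'rV[int]_d]].

(* M_j = Z^d + Z lam`_0 + ... + Z lam`_j.-1: indices in [lam], [nn], [lbar] start
   from 0, so that [nth 0%N nn j] is the index of M_j in M_{j+1}. *)
Fixpoint lattice lam (j : nat) : set 'rV[rat]_d :=
  if j is i.+1 then
    [set x | exists y (z : int), lattice lam i y /\ x = y + lam`_i *~ z]
  else int_lattice.

Definition lattice_basis (L : set 'rV[rat]_d) (B : 'M[rat]_d) : Prop :=
  B \in unitmx /\
  forall x, L x <-> exists a : 'rV[int]_d, x = map_mx intr a *m B.

Fixpoint lbar lam nn (j : nat) : 'rV[rat]_d :=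
  if j is i.+1 then lbar lam nn i *+ nth 0%N nn i + (lam`_i.+1 - lam`_i)
  else lam`_0.

Definition gam (g : nat) lam nn (i : 'I_(d + g)) : 'rV[rat]_d :=
  match split i with
  | inl i => delta_mx 0 i
  | inr j => lbar lam nn j
  end.

Definition psi (g : nat) lam nn (a : 'X_{1..d + g}) : 'rV[rat]_d :=
  \sum_i gam lam nn i *+ a i.

Definition gamma0 (g : nat) lam nn : 'rV[rat]_d :=
  \sum_(j < g) lbar lam nn j *+ (nth 0%N nn j).-1 - \sum_(i < d) delta_mx 0 i.

Definition semigroup_relation (g : nat) lam nn (j : 'I_g)
    (l : 'X_{1..d + g}) : Prop :=
  [/\ forall i : 'I_(d + g), (d + j <= i)%N -> l i = 0%N,
      forall k : 'I_g, (k < j)%N -> (l (rshift d k) < nth 0%N nn k)%N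
    & lbar lam nn j *+ nth 0%N nn j = psi lam nn l].

End Exponents.

(* The ring C[[X^{1/n}]] is represented by [fps R[i] d], whose variables are
   the X_i^{1/n}: the coefficient at [a] is that of X^{a/n}. All of C{X},
   C{X^{1/n}} and O_Z are subrings of it, given by the convergence and by the
   support of the series. *)

Section FractionalSeries.
Variables (R : realType) (d n : nat).
Local Notation C := R[i].
Implicit Types (phi : fps C d) (x : 'rV[rat]_d) (L : set 'rV[rat]_d).

(* absolute convergence at (r, ..., r) *)
Definition convergent (k : nat) : set (fps C k) :=
  [set F | exists r b : C, 0 < r /\
     forall s : seq 'X_{1..k}, uniq s ->
       \sum_(a <- s) `|F a| * r ^+ mdeg a <= b].

Definition expo (a : 'X_{1..d}) : 'rV[rat]_d := \row_i ((a i)%:R / n%:R).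

(* X^x if [x] lies in (1/n) Z^d_{>=0}, and 0 otherwise *)
Definition Xmon x : fps C d := Fps (fun a => (expo a == x)%:R).

(* X^x for [x] in (1/n) Z^d *)
Definition Xfrac x : {fraction fps C d} :=
  tofrac (Xmon (map_mx (Num.max 0) x)) /
  tofrac (Xmon (map_mx (Num.max 0) (- x))).

(* convergent series with exponents in the intersection of [L] with the
   nonnegative orthant *)
Definition pser L : set (fps C d) :=
  [set phi | convergent phi /\ forall a, phi a != 0 -> L (expo a)].

Definition CX : set (fps C d) := pser (@int_lattice d).
Definition CXY : set {poly fps C d} := [set f | forall i, CX f`_i].

Definition weierstrass (f : {poly fps C d}) : Prop :=
  [/\ f \is monic, CXY f
    & forall i, (i < (size f).-1)%N -> f`_i 0%MM = 0].

Definition quasi_ordinary (f : {poly fps C d}) : Prop :=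
  exists (delta : 'X_{1..d}) (eps : fps C d), unit_in CX eps /\
    discriminant f = Xmon (\row_i (delta i)%:R) * eps.

Definition char_exponent (f : {poly fps C d}) : set 'rV[rat]_d :=
  [set x | exists z z' u : fps C d,
     [/\ convergent z, convergent z', root f z & root f z'] /\
     [/\ z != z', unit_in (@convergent d) u & z - z' = Xmon x * u]].

Definition qo_hypersurface (g : nat) (lam : g.-tuple 'rV[rat]_d)
    (f : {poly fps C d}) : Prop :=
  [/\ size f = n.+1, weierstrass f, irreducible_in CXY f & quasi_ordinary f] /\
  [/\ forall x, char_exponent f x <-> x \in lam
    & forall i j, (i < j < g)%N -> prec lam`_i lam`_j].

(* eta (d phi), in the coordinates given by the rows of [B], a basis of M *)
Definition log_diff (B : 'M[rat]_d) phi : 'rV[fps C d]_d :=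
  \row_k Fps (fun a => phi a * ratr ((expo a *m invmx B) 0 k)).

(* image of Omega^1_W in O_Z (x) M, where O_W is the subring [OW] of O_Z *)
Definition log_forms (B : 'M[rat]_d) (OW : set (fps C d)) :
    set 'rV[fps C d]_d :=
  [set w | exists (m : nat) (a phi : 'I_m -> fps C d),
     (forall i, OW (a i) /\ OW (phi i)) /\
     w = \sum_(i < m) a i *: log_diff B (phi i)].

(* The exterior products w_1 /\ ... /\ w_d generate Omega^d_W; in the basis [B]
   their images are determinants. *)
Definition log_jacobian (B : 'M[rat]_d) (OZ OW : set (fps C d)) :
    set (fps C d) :=
  ideal_gen OZ [set \det A | A in
    [set A : 'M[fps C d]_d | forall k, log_forms B OW (row k A)]].

End FractionalSeries.

Section Deformation.
Variables (R : realType) (d n g : nat).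
Local Notation C := R[i].
Variables (lam : g.-tuple 'rV[rat]_d) (nn : g.-tuple nat).
Variable ell : 'I_g -> 'X_{1..d + g}.

Definition torus_point (L : set 'rV[rat]_d) (p : 'rV[rat]_d -> C) : Prop :=
  (forall x, L x -> p x != 0) /\
  (forall x y, L x -> L y -> p (x + y) = p x * p y).

Definition hbinomial (j : 'I_g) : fps C (d + g) :=
  fps_mon 1 (ell j) - fps_mon 1 (U_(rshift d j) *+ nth 0%N nn j)%MM.

(* [c1] gives the c_j and [c] the c_alpha. *)
Definition overweight (c1 : 'I_g -> C) (c : 'I_g -> 'X_{1..d + g} -> C) : Prop :=
  (forall j : 'I_g, (j.+1 < g)%N -> c1 j != 0) /\
  (forall (j : 'I_g) a, c j a != 0 ->
     (forall i : 'I_(d + g), (d + j < i)%N -> a i = 0%N) /\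
     prec (lbar lam nn j *+ nth 0%N nn j) (psi lam nn a)).

(* H_{j,p}; the sum over [k] has a single term if j.+1 < g, and none for the last
   equation, where there is no further variable. *)
Definition deform (c1 : 'I_g -> C) (c : 'I_g -> 'X_{1..d + g} -> C)
    (p : 'rV[rat]_d -> C) (j : 'I_g) : fps C (d + g) :=
  hbinomial j
  + \sum_(k < g | k == j.+1 :> nat)
      fps_mon (c1 j * p (lbar lam nn j.+1 - lbar lam nn j *+ nth 0%N nn j))
              U_(rshift d k)%MM
  + Fps (fun a => c j a * p (psi lam nn a - lbar lam nn j *+ nth 0%N nn j)).

Definition minors (H : 'I_g -> fps C (d + g)) : set (fps C (d + g)) :=
  [set D | exists s : 'I_g -> 'I_(d + g),
     (forall i k : 'I_g, (i < k)%N -> (s i < s k)%N) /\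
     D = \det (\matrix_(j, k) fps_deriv (s k) (H j))].

(* the images of U_1, ..., U_{d+g} *)
Definition coords (zeta : 'I_g -> fps C d) (i : 'I_(d + g)) : fps C d :=
  match split i with
  | inl i => Xmon R n (delta_mx 0 i)
  | inr j => zeta j
  end.

Definition OZ : set (fps C d) := pser n (lattice lam g).

(* The homomorphism from the local ring of S_p to its integral closure O_Z; it
   is determined by the quasi-ordinary branch [zeta 0], the other [zeta j] being
   given by elimination from the equations H_{j,p} = 0. *)
Definition parametrization (H : 'I_g -> fps C (d + g))
    (zeta : 'I_g -> fps C d) : Prop :=
  [/\ forall j, OZ (zeta j) /\ zeta j 0%MM = 0,
      forall j, fps_eval (H j) (coords zeta) = 0
    & forall j : 'I_g, j = 0 :> nat ->
        exists2 f, qo_hypersurface n lam f & root f (zeta j)].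

(* the local ring of S_p, as a subring of O_Z *)
Definition OS (zeta : 'I_g -> fps C d) : set (fps C d) :=
  [set fps_eval F (coords zeta) | F in @convergent R (d + g)].

(* Jac(S_p) O_Z *)
Definition jacobian (H : 'I_g -> fps C (d + g)) (zeta : 'I_g -> fps C d) :
    set (fps C d) :=
  ideal_gen OZ [set fps_eval D (coords zeta) | D in minors H].

End Deformation.

(* Main.v *)
(** Let [W] be the matrix of the logarithmic differentials of the coordinates
    U_1, ..., U_{d+g} along the branch, and [N] the Jacobian matrix of H_1, ..., H_g,
    so that [N *m W = 0] by the chain rule. A generator of the logarithmic Jacobian
    ideal has the form det (P W), and multiplying [P; N] by [W | (0; 1)] gives
      det [P; N] * det W' = det (P W) * det N',
    where W' consists of the rows of U_1, ..., U_d and N' of the columns of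
    U_{d+1}, ..., U_{d+g}. By Laplace expansion det [P; N] lies in the Jacobian ideal;
    det W' is a constant times X_1 ... X_d. Giving U_i the weight gamma_i, the H_j force
    the j-th coordinate of the branch to be X^{lbar_j} times a unit; the binomials then
    dominate N', and det N' is X^{sum (n_j - 1) lbar_j} times a unit. The quotient of the
    two monomials is X^{gamma_0}. *)

From HB Require Import structures.
Require Import Defs.
From mathcomp Require Import all_boot all_order all_algebra.
From mathcomp Require Import fraction.
From mathcomp Require Import boolp classical_sets reals.
From mathcomp Require Import complex.
From mathcomp Require Import mpoly ssrcomplements.
From mathcomp Require Import zify ring.

Set Implicit Arguments.
Unset Strict Implicit.
Unset Printing Implicit Defensive.

Import Order.TTheory GRing.Theory Num.Theory.
Local Open Scope ring_scope.

(** * Formal power series *)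

(** The exponents are only partially ordered, so a solution z_i of the system has no smallest
    exponent a priori. Auxiliary positive integral weights on the X_i restore a total order: for
    each of them the order of z_i is at least that of X^{gamma_i}, by an extremal argument on the
    ratios of these orders, and weights concentrated on one variable then give divisibility by
    X^{gamma_i}. The quotients do not vanish at 0: their values there satisfy the binomial
    equations, which express a power of each one by the preceding ones, starting from 1 for X_1,
    ..., X_d. Dividing by the unit in det N' must not leave O_Z, so convergence and support in M
    have to be stable under inversion. All exponents are multiplied by n, which turns them into
    multi-indices of natural numbers. *)

Lemma lem_antisym k (a b : 'X_{1..k}) : (a <= b)%MM -> (b <= a)%MM -> a = b.
Proof.
move=> /mnm_lepP ab /mnm_lepP ba; apply/mnmP => i.
by apply/eqP; rewrite eqn_leq ab ba.
Qed.

Section SeriesAlgebra.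
Variables (K : fieldType) (k : nat).
Implicit Types (f g : fps K k) (a b m : 'X_{1..k}).

Lemma coefs1 a : (1 : fps K k) a = (a == 0%MM)%:R. Proof. by []. Qed.

Lemma coefsD f g a : (f + g) a = f a + g a. Proof. by []. Qed.

Lemma coefsN f a : (- f) a = - f a. Proof. by []. Qed.

Lemma coefs_sum (I : Type) (r : seq I) (P : pred I) (F : I -> fps K k) a :
  (\sum_(i <- r | P i) F i) a = \sum_(i <- r | P i) F i a.
Proof. by apply: (big_morph (fun f : fps K k => f a)). Qed.

Lemma coefsMn f j a : (f *+ j) a = f a *+ j.
Proof. by elim: j => [|j IHj]; rewrite ?mulr0n // !mulrS coefsD IHj. Qed.

Lemma coefsM N f g a : (mdeg a < N)%N ->
  (f * g) a = \sum_(h : 'X_{1..k < N} | (h <= a)%MM) f h * g (a - h)%MM.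
Proof.
move=> aN; rewrite [LHS](fps_mulE (b := N)) // (mcoeff_poly_mul_lin _ _ aN) /=.
apply: eq_bigr => h lehm; rewrite !fps_truncE ?bmdeg //.
by rewrite (leq_ltn_trans (mdegB _ _)).
Qed.

Lemma coefsM_neq0 f g a : (f * g) a != 0 ->
  exists b b', [/\ a = (b + b')%MM, f b != 0 & g b' != 0].
Proof.
move=> fga; apply: contrapT => no; case/eqP: fga.
rewrite (coefsM _ _ (ltnSn _)) big1 // => h ha; apply/eqP; rewrite mulf_eq0.
apply: contrapT => /negP; rewrite negb_or => /andP[fh gh]; apply: no.
by exists (h : 'X_{1..k}), (a - h)%MM; rewrite addmC submK.
Qed.

(** If a' >= a, b' >= b and a' + b' = a + b, then a' = a: a single term of the convolution
    survives. *)
Lemma coefsM_lead f g a b : (forall a', f a' != 0 -> (a <= a')%MM) ->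
  (forall b', g b' != 0 -> (b <= b')%MM) -> (f * g) (a + b)%MM = f a * g b.
Proof.
move=> fa gb; rewrite (coefsM _ _ (ltnSn _)).
have ltab : (mdeg a < (mdeg (a + b)).+1)%N by rewrite ltnS mdegD leq_addr.
rewrite (bigD1 (BMultinom ltab)) /=; last exact: lem_addr.
have -> : (a + b - a)%MM = b by rewrite [(a + b)%MM]addmC addmK.
rewrite big1 ?addr0 // => h /andP[]; rewrite bmeqP /=.
move: (bmnm h) => c cab cna; apply/eqP; rewrite mulf_eq0.
apply: contrapT => /negP; rewrite negb_or => /andP[/fa ac /gb].
move=> /mnm_lepP bc; case/eqP: cna; apply: lem_antisym => //.
apply/mnm_lepP => i; have := bc i.
move/mnm_lepP: cab => /(_ i); rewrite !mnmBE !mnmDE; lia.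
Qed.

Lemma coefsM0 f g : (f * g) 0%MM = f 0%MM * g 0%MM.
Proof.
by rewrite -[in LHS](addm0 0%MM) coefsM_lead // => a _; apply/mnm_lepP => i; rewrite mnm0E.
Qed.

Lemma coefs_mon (c : K) m a : fps_mon c m a = c *+ (a == m). Proof. by []. Qed.

Lemma coefs_mon_neq0 (c : K) m a : fps_mon c m a != 0 -> a = m.
Proof. by rewrite coefs_mon; case: (eqVneq a m) => // _; rewrite mulr0n eqxx. Qed.

Lemma coefs_monM c m f a : (fps_mon c m * f) (m + a)%MM = c * f a.
Proof.
rewrite (coefsM _ _ (ltnSn _)).
have ltm : (mdeg m < (mdeg (m + a)).+1)%N by rewrite ltnS mdegD leq_addr.
rewrite (bigD1 (BMultinom ltm)) /=; last exact: lem_addr.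
rewrite big1 ?addr0 => [|h /andP[_]]; last first.
  by rewrite bmeqP /= => /negbTE ->; rewrite mulr0n mul0r.
by rewrite eqxx [(m + a)%MM]addmC addmK.
Qed.

Lemma coefs_monM_neq0 c m f a : (fps_mon c m * f) a != 0 -> (m <= a)%MM.
Proof.
by case/coefsM_neq0 => b [b' [-> /coefs_mon_neq0 ->]] _; exact: lem_addr.
Qed.

Lemma fps_mon1 : fps_mon 1 0%MM = 1 :> fps K k.
Proof. by exact: fpsP. Qed.

Lemma fps_monM (c c' : K) m m' : fps_mon c m * fps_mon c' m' = fps_mon (c * c') (m + m')%MM.
Proof.
apply: fpsP => a; have [->|am] := eqVneq a (m + m')%MM.
  by rewrite coefs_monM !coefs_mon !eqxx.
rewrite coefs_mon (negbTE am); apply/eqP; apply: contraNT am.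
by move=> /coefsM_neq0[b [b' [-> /coefs_mon_neq0 -> /coefs_mon_neq0 ->]]].
Qed.

Lemma fps_monX m j : fps_mon 1 m ^+ j = fps_mon 1 (m *+ j)%MM :> fps K k.
Proof.
elim: j => [|j IHj]; first by rewrite expr0 mulm0n fps_mon1.
by rewrite exprS IHj fps_monM mul1r mulmS.
Qed.

Lemma fps_mon_prod (I : finType) (P : pred I) (m : I -> 'X_{1..k}) :
  \prod_(i | P i) fps_mon 1 (m i) = fps_mon 1 (\sum_(i | P i) m i)%MM :> fps K k.
Proof.
by rewrite -fps_mon1; elim/big_rec2: _ => // i y x _ ->; rewrite fps_monM mul1r.
Qed.

Lemma fps_mon_neq0 m : fps_mon 1 m != 0 :> fps K k.
Proof.
apply/eqP => /(congr1 (fun f : fps K k => f m)) /=; rewrite eqxx.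
exact/eqP/oner_neq0.
Qed.

Lemma fps_factor f m : (forall a, f a != 0 -> (m <= a)%MM) ->
  f = fps_mon 1 m * Fps (fun a => f (m + a)%MM).
Proof.
move=> fm; apply: fpsP => a; have [ma|nma] := boolP (m <= a)%MM.
  by rewrite -(submK ma) addmC coefs_monM mul1r.
have -> : f a = 0 by apply/eqP; apply: contraNT nma => /fm.
by apply/esym/eqP; apply: contraNT nma; exact: coefs_monM_neq0.
Qed.

Definition fpsC (c : K) : fps K k := fps_mon c 0%MM.

Lemma coefs_fpsCM c f a : (fpsC c * f) a = c * f a.
Proof. by rewrite -{1}(add0m a) coefs_monM. Qed.

Lemma fpsC_zmod_morphism : zmod_morphism fpsC.
Proof. by move=> c c'; apply: fpsP => a; rewrite coefsD coefsN !coefs_mon mulrnBl. Qed.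

Lemma fpsC_monoid_morphism : monoid_morphism fpsC.
Proof. by split=> [|c c']; rewrite /fpsC ?fps_mon1 // fps_monM addm0. Qed.

HB.instance Definition _ :=
  GRing.isZmodMorphism.Build K (fps K k) fpsC fpsC_zmod_morphism.
HB.instance Definition _ :=
  GRing.isMonoidMorphism.Build K (fps K k) fpsC fpsC_monoid_morphism.

(** Evaluation at 0 gets a name in order to carry a ring morphism structure, and so to pass through
    products, powers and determinants. *)
Definition const_coef f := f 0%MM.

Lemma const_coef_zmod_morphism : zmod_morphism const_coef.
Proof. by []. Qed.

Lemma const_coef_monoid_morphism : monoid_morphism const_coef.
Proof. by split=> [|f g]; rewrite /const_coef ?coefsM0 // coefs1 eqxx. Qed.

HB.instance Definition _ :=
  GRing.isZmodMorphism.Build (fps K k) K const_coef const_coef_zmod_morphism.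
HB.instance Definition _ :=
  GRing.isMonoidMorphism.Build (fps K k) K const_coef const_coef_monoid_morphism.

(* Congruence modulo the series of order at least [N], which reduces identities
   between series to identities between polynomials. *)
Definition fps_eqm N f g := forall a, (mdeg a < N)%N -> f a = g a.

Lemma fps_eqm_mul N f f' g g' :
  fps_eqm N f f' -> fps_eqm N g g' -> fps_eqm N (f * g) (f' * g').
Proof.
move=> ff' gg' a aN; rewrite !(coefsM _ _ aN); apply: eq_bigr => h ha.
by rewrite ff' ?gg' ?bmdeg // (leq_ltn_trans (mdegB _ _)).
Qed.

(** A truncation that stays in the ring of series, as a finite sum of monomials to which additive
    maps apply term by term. *)
Definition fps_poly N f : fps K k := \sum_(a : 'X_{1..k < N}) fps_mon (f a) a.

Lemma big_bmnm_delta N (F : 'X_{1..k} -> K) a : (mdeg a < N)%N ->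
  \sum_(b : 'X_{1..k < N}) F b *+ (a == b) = F a.
Proof.
move=> aN; rewrite (bigD1 (BMultinom aN)) //= eqxx big1 ?addr0 // => b.
by rewrite bmeqP /= eq_sym => /negbTE ->.
Qed.

Lemma fps_poly_eqm N f : fps_eqm N f (fps_poly N f).
Proof. by move=> a aN; rewrite coefs_sum (big_bmnm_delta f aN). Qed.

Lemma fps_eqmP f g : (forall N, fps_eqm N f g) -> f = g.
Proof. by move=> fg; apply: fpsP => a; apply: (fg (mdeg a).+1). Qed.

End SeriesAlgebra.

Arguments const_coef {K k} f : simpl never.

(** * Logarithmic derivations *)

Section Euler.
Variables (K : fieldType) (k : nat) (chi : 'X_{1..k} -> K).
Hypothesis chiD : forall a b, chi (a + b)%MM = chi a + chi b.
Implicit Types f g : fps K k.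

(** The coordinates of [log_diff] are operators of this kind, [chi] being a coordinate of the
    exponent in a basis of the lattice. *)
Definition euler f := Fps (fun a => f a * chi a).

Lemma euler_zmod_morphism : zmod_morphism euler.
Proof. by move=> f g; apply: fpsP => a /=; rewrite mulrBl. Qed.

HB.instance Definition _ :=
  GRing.isZmodMorphism.Build (fps K k) (fps K k) euler euler_zmod_morphism.

Lemma eulerM f g : euler (f * g) = euler f * g + f * euler g.
Proof.
apply: fpsP => a; rewrite coefsD [LHS]/= !(coefsM _ _ (ltnSn _)).
rewrite mulr_suml -big_split; apply: eq_bigr => h ha /=.
have -> : chi a = chi (a - h)%MM + chi h by rewrite -chiD submK.
by ring.
Qed.

Lemma euler1 : euler 1 = 0.
Proof.
have /(congr1 (fun x => x - euler 1)) := eulerM 1 1.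
by rewrite !mulr1 mul1r subrr addrK.
Qed.

Lemma eulerX f j : euler (f ^+ j) = f ^+ j.-1 * euler f *+ j.
Proof.
elim: j => [|[|j] IHj]; first by rewrite expr0 euler1 mulr0n.
  by rewrite expr1 expr0 mul1r.
by rewrite exprS eulerM IHj -mulrnAr mulrA -exprS /= -mulrnAr [in RHS]mulrS mulrDr mulrC.
Qed.

Lemma euler_prod (I : eqType) (r : seq I) (F : I -> fps K k) : uniq r ->
  euler (\prod_(i <- r) F i) =
  \sum_(i <- r) (\prod_(j <- r | j != i) F j) * euler (F i).
Proof.
elim: r => [|i r IHr] /=; first by rewrite !big_nil euler1.
case/andP=> ir ur; rewrite !big_cons eulerM IHr // eqxx /= addrC addrC mulrC.
congr (_ * _ + _).
  rewrite big_seq_cond [RHS]big_seq_cond; apply: eq_bigl => j.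
  by case: eqP => [->|]; rewrite ?(negbTE ir) ?andbT.
rewrite mulr_sumr; apply: eq_big_seq => j jr; rewrite big_cons mulrA.
by case: eqP jr => [<-|//]; rewrite (negbTE ir).
Qed.

End Euler.

Lemma big_bmnm_widen (V : nmodType) k N N' (F : 'X_{1..k} -> V) :
  (forall a, (N <= mdeg a)%N -> F a = 0) -> (N <= N')%N ->
  \sum_(a : 'X_{1..k < N'}) F a = \sum_(a : 'X_{1..k < N}) F a.
Proof.
move=> F0 NN'; apply/esym.
pose I1 : subFinType _ := 'X_{1..k < N}; pose I2 : subFinType _ := 'X_{1..k < N'}.
rewrite (big_sub_widen I1 I2 xpredT F) /=; last by move=> x /leq_trans; apply.
by rewrite big_rmcond // => a; rewrite -leqNgt => /F0.
Qed.

(** * Weighted orders and initial forms *)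

Section Order.
Variables (K : fieldType) (d : nat) (w : 'X_{1..d} -> nat).
Hypothesis wD : forall a b, w (a + b)%MM = (w a + w b)%N.
Implicit Types (f g : fps K d) (s t : nat).

Definition ord_ge s f := forall a, f a != 0 -> (s <= w a)%N.

Lemma ord_ge1 : ord_ge 0 1. Proof. by []. Qed.

Lemma ord_geM s t f g : ord_ge s f -> ord_ge t g -> ord_ge (s + t) (f * g).
Proof.
by move=> fs gt a /coefsM_neq0[b [b' [-> /fs sb /gt tb]]]; rewrite wD leq_add.
Qed.

Lemma ord_geX s j f : ord_ge s f -> ord_ge (s * j) (f ^+ j).
Proof.
move=> fs; elim: j => [|j IHj]; first by rewrite muln0.
by rewrite exprS mulnS; apply: ord_geM.
Qed.

Lemma ord_ge_prod (I : finType) (F : I -> fps K d) (s : I -> nat) :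
  (forall i, ord_ge (s i) (F i)) -> ord_ge (\sum_i s i) (\prod_i F i).
Proof. by move=> Fs; elim/big_rec2: _ => // i f t _ ft; apply: ord_geM. Qed.

(** The initial form of [f] if [f] has order [s], and 0 if its order is larger. *)
Definition part s f := Fps (fun a => f a *+ (w a == s)).

Lemma partM s t f g : ord_ge s f -> ord_ge t g ->
  part (s + t) (f * g) = part s f * part t g.
Proof.
move=> fs gt; apply: fpsP => a; rewrite [LHS]/= !(coefsM _ _ (ltnSn _)) -sumrMnl.
apply: eq_bigr => h ha /=; have -> : w a = (w (a - h)%MM + w h)%N by rewrite -wD submK.
have [->|/fs sh] := eqVneq (f h) 0; first by rewrite !(mul0r, mul0rn).
have [->|/gt tah] := eqVneq (g (a - h)%MM) 0; first by rewrite !(mulr0, mul0rn).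
rewrite mulrnAl mulrnAr -mulrnA mulnb; congr (_ *+ nat_of_bool _).
by apply/eqP/andP => [|[/eqP -> /eqP ->]]; lia.
Qed.

Lemma partX s j f : ord_ge s f -> part (s * j) (f ^+ j) = part s f ^+ j.
Proof.
move=> fs; elim: j => [|j IHj]; last first.
  by rewrite !exprS mulnS partM ?IHj //; apply: ord_geX.
rewrite muln0 !expr0; apply: fpsP => a /=.
have [->|] := eqVneq a 0%MM; last by rewrite mulr0n mul0rn.
suff -> : w 0%MM = 0%N by rewrite eqxx.
by have := wD 0%MM 0%MM; rewrite addm0; lia.
Qed.

(** The initial form of [f] is nonzero, and so is its power because the series form a domain; by
    [partX] this power is the component of [f ^+ j] of weight [s * j]. *)
Lemma ordX_attained s j f a : ord_ge s f -> f a != 0 -> w a = s ->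
  exists2 b, w b = (s * j)%N & (f ^+ j) b != 0.
Proof.
move=> fs fa was; apply: contrapT => no.
have /eqP : part s f != 0.
  apply/eqP => /(congr1 (fun f : fps K d => f a)) /=.
  by rewrite was eqxx mulr1n; apply/eqP.
apply; apply/eqP; have := expf_eq0 (part s f) j.
case: (part s f == 0); rewrite ?andbT ?andbF //.
rewrite -partX // => /eqP[]; apply: fpsP => b /=.
case: eqP => // wb; rewrite mulr1n; apply: contrapT => /eqP fb.
by apply: no; exists b.
Qed.

End Order.

(** * Substitution of series without constant term, and the chain rule *)

Section Evaluation.
Variables (K : fieldType) (k d : nat) (z : 'I_k -> fps K d).
Hypothesis z0 : forall i, z i 0%MM = 0.
Implicit Types (F G : fps K k) (a : 'X_{1..k}) (b : 'X_{1..d}).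

Definition zmon a : fps K d := \prod_(i < k) z i ^+ a i.

Lemma zmon0 : zmon 0%MM = 1.
Proof. by apply: big1 => i _; rewrite mnm0E. Qed.

Lemma zmonD a a' : zmon (a + a')%MM = zmon a * zmon a'.
Proof. by rewrite -big_split; apply: eq_bigr => i _; rewrite mnmDE exprD. Qed.

Lemma zmonU i : zmon U_(i)%MM = z i.
Proof.
rewrite /zmon (bigD1 i) //= mnm1E eqxx big1 ?mulr1 // => j /negbTE ji.
by rewrite mnm1E eq_sym ji.
Qed.

Lemma ord_ge_zmon (w : 'X_{1..d} -> nat) (s : 'I_k -> nat) a :
    (forall b b', w (b + b')%MM = (w b + w b')%N) ->
    (forall i, a i != 0%N -> ord_ge w (s i) (z i)) ->
  ord_ge w (\sum_i s i * a i) (zmon a).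
Proof.
move=> wD zs; apply: ord_ge_prod => // i; have [->|/zs zsi] := eqVneq (a i) 0%N.
  by rewrite muln0; apply: ord_ge1.
exact: ord_geX.
Qed.

(** Each [z i] has order at least 1. Consequently the sum in [fps_eval] may be extended to any
    larger range of exponents. *)
Lemma zmon_mdeg a b : (mdeg b < mdeg a)%N -> zmon a b = 0.
Proof.
move=> ba; apply/eqP; apply: contraTT ba => zab; rewrite -leqNgt mdegE.
under eq_bigr => i _ do rewrite -[a i]mul1n.
apply: (@ord_ge_zmon mdeg (fun=> 1%N)) zab => [b1 b2|i _ c]; first exact: mdegD.
by rewrite lt0n mdeg_eq0; apply: contraNneq => ->; rewrite z0.
Qed.

Lemma coefs_evalE N F b : (mdeg b < N)%N ->
  fps_eval F z b = \sum_(a : 'X_{1..k < N}) F a * zmon a b.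
Proof.
move=> bN; rewrite (@big_bmnm_widen _ _ (mdeg b).+1 N (fun a => F a * zmon a b)) //.
by move=> a ba; rewrite zmon_mdeg ?mulr0.
Qed.

Lemma coefs_eval_neq0 F b : fps_eval F z b != 0 ->
  exists2 a, F a != 0 & zmon a b != 0.
Proof.
move=> Fb; apply: contrapT => no; case/eqP: Fb; apply: big1 => a _.
apply/eqP; rewrite mulf_eq0; apply: contrapT => /negP; rewrite negb_or => /andP[Fa ab].
by apply: no; exists (a : 'X_{1..k}).
Qed.

Lemma fps_eval_eqm N F G : fps_eqm N F G -> fps_eqm N (fps_eval F z) (fps_eval G z).
Proof.
move=> FG b bN; rewrite !(coefs_evalE _ bN).
by apply: eq_bigr => a _; rewrite FG ?bmdeg.
Qed.

(* The proof is an argument so that the morphism structure can be inferred. *)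
Definition evalz of (forall i, z i 0%MM = 0) := fun F => fps_eval F z.
Local Notation ev := (evalz z0).

Lemma eval_zmod_morphism : zmod_morphism ev.
Proof.
move=> F G; apply: fpsP => b; rewrite coefsD coefsN /= -sumrB.
by apply: eq_bigr => a _; rewrite mulrBl.
Qed.

HB.instance Definition _ :=
  GRing.isZmodMorphism.Build (fps K k) (fps K d) ev eval_zmod_morphism.

Lemma eval_mon (c : K) a : ev (fps_mon c a) = fpsC d c * zmon a.
Proof.
apply: fpsP => b; rewrite coefs_fpsCM (@coefs_evalE (maxn (mdeg b) (mdeg a)).+1); last first.
  by rewrite ltnS leq_maxl.
under eq_bigr => a' _ do rewrite coefs_mon mulrnAl eq_sym.
by rewrite (@big_bmnm_delta _ _ _ (fun a => c * zmon a b)) // ltnS leq_maxr.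
Qed.

Lemma eval_monoid_morphism : monoid_morphism ev.
Proof.
split=> [|F G]; first by rewrite -fps_mon1 eval_mon zmon0 mulr1 rmorph1.
apply: fps_eqmP => N b bN.
(* Below degree [N] only truncations of [F] and [G] matter, and for these multiplicativity reduces
   to [zmonD] on monomials. *)
have FGN := fps_eqm_mul (fps_poly_eqm (N := N) F) (fps_poly_eqm (N := N) G).
rewrite (fps_eval_eqm FGN bN).
rewrite (fps_eqm_mul (fps_eval_eqm (fps_poly_eqm F)) (fps_eval_eqm (fps_poly_eqm G)) bN).
congr (coefs _ b); rewrite -!/(ev _) /fps_poly mulr_suml !raddf_sum mulr_suml.
apply: eq_bigr => a _; rewrite !mulr_sumr raddf_sum; apply: eq_bigr => a' _ /=.
by rewrite fps_monM !eval_mon rmorphM zmonD mulrACA.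
Qed.

HB.instance Definition _ :=
  GRing.isMonoidMorphism.Build (fps K k) (fps K d) ev eval_monoid_morphism.

Lemma eval_var i : ev (fps_mon 1 U_(i)%MM) = z i.
Proof. by rewrite eval_mon rmorph1 mul1r zmonU. Qed.

Section ChainRule.
Variable chi : 'X_{1..d} -> K.
Hypothesis chiD : forall b b', chi (b + b')%MM = chi b + chi b'.

Lemma euler_fpsC c : euler chi (fpsC d c) = 0.
Proof.
apply: fpsP => b /=; have [->|] := eqVneq b 0%MM; last by rewrite mulr0n mul0r.
suff -> : chi 0%MM = 0 by rewrite mulr0.
have /(congr1 (fun x => x - chi 0%MM)) := chiD 0%MM 0%MM.
by rewrite addm0 subrr addrK.
Qed.

Lemma euler_zmon a :
  euler chi (zmon a) = \sum_i (zmon (a - U_(i))%MM * euler chi (z i)) *+ a i.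
Proof.
rewrite /zmon euler_prod ?index_enum_uniq //; apply: eq_bigr => i _.
rewrite eulerX // mulrnAr; have [->|ai] := eqVneq (a i) 0%N; first by rewrite !mulr0n.
congr (_ *+ _); rewrite mulrA; congr (_ * _).
rewrite [RHS](bigD1 i) //= mulrC mnmBE mnm1E eqxx subn1; congr (_ * _).
by apply: eq_bigr => j /negbTE ji; rewrite mnmBE mnm1E eq_sym ji subn0.
Qed.

Lemma deriv_mon (i : 'I_k) (c : K) a :
  fps_deriv i (fps_mon c a) = fps_mon (c *+ a i) (a - U_(i))%MM.
Proof.
apply: fpsP => b; rewrite /=; have [ai|ai] := eqVneq (a i) 0%N.
  rewrite ai mulr0n mul0rn; case: eqP => [ba|_]; last by rewrite mulr0n mul0rn.
  by move: ai; rewrite -ba mnmDE mnm1E eqxx addn1.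
have Ua : (U_(i) <= a)%MM.
  by apply/mnm_lepP => j; rewrite mnm1E; case: eqP => // <-; rewrite lt0n.
have [->|ba] := eqVneq b (a - U_(i))%MM.
  by rewrite submK // eqxx mulr1n mnmBE mnm1E eqxx subn1 prednK ?lt0n.
case: eqP => [ab|_]; last by rewrite mul0rn.
by case/eqP: ba; rewrite -ab addmK.
Qed.

Lemma chain_rule F :
  euler chi (ev F) = \sum_i ev (fps_deriv i F) * euler chi (z i).
Proof.
apply: fps_eqmP => N b bN.
(* The bound is [N.+1] because a derivative lowers degrees by one: its coefficients below degree [N]
   involve those of [F] up to degree [N]. *)
have eqF := fps_poly_eqm (N := N.+1) F.
have -> : euler chi (ev F) b = euler chi (ev (fps_poly N.+1 F)) b.
  by congr (_ * _); apply: (fps_eval_eqm eqF); apply: ltnW.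
have -> : (\sum_i ev (fps_deriv i F) * euler chi (z i)) b =
    (\sum_i ev (fps_deriv i (fps_poly N.+1 F)) * euler chi (z i)) b.
  rewrite !coefs_sum; apply: eq_bigr => i _.
  apply: (fps_eqm_mul _ (fun _ _ => erefl)) bN; apply: fps_eval_eqm => a aN /=.
  by rewrite eqF // mdegD mdeg1 addn1.
congr (coefs _ b); rewrite /fps_poly !raddf_sum /=.
transitivity (\sum_(i < k) \sum_(a : 'X_{1..k < N.+1})
    ev (fps_deriv i (fps_mon (F a) a)) * euler chi (z i)); last first.
  apply: eq_bigr => i _; rewrite -mulr_suml -raddf_sum; congr (ev _ * _).
  by apply: fpsP => a; rewrite coefs_sum /= !coefs_sum sumrMnl.
rewrite exchange_big; apply: eq_bigr => a _ /=.
rewrite eval_mon eulerM // euler_fpsC mul0r add0r euler_zmon mulr_sumr.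
apply: eq_bigr => i _; rewrite deriv_mon eval_mon raddfMn.
by rewrite !mulrnAl mulrnAr mulrA.
Qed.

End ChainRule.

End Evaluation.

(** * Minors *)

Section Subrings.
Variables (S : comNzRingType) (A : set S).

Definition subring_set := [/\ A 1, forall x y, A x -> A y -> A (x - y)
  & forall x y, A x -> A y -> A (x * y)].

Hypothesis hA : subring_set.

Lemma subring_set0 : A 0.
Proof. by case: hA => A1 AB _; rewrite -(subrr 1); apply: AB. Qed.

Lemma subring_setN x : A x -> A (- x).
Proof. by case: hA => _ AB _ Ax; rewrite -sub0r; apply: AB => //; exact: subring_set0. Qed.

Lemma subring_setD x y : A x -> A y -> A (x + y).
Proof.
case: hA => _ AB _ Ax Ay; rewrite -[y]opprK.
by apply: AB => //; apply: subring_setN.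
Qed.

Lemma subring_set_sum (I : Type) (r : seq I) (P : pred I) (F : I -> S) :
  (forall i, P i -> A (F i)) -> A (\sum_(i <- r | P i) F i).
Proof. by move=> AF; apply: big_ind => //; [exact: subring_set0 | exact: subring_setD]. Qed.

Lemma subring_set_prod (I : Type) (r : seq I) (P : pred I) (F : I -> S) :
  (forall i, P i -> A (F i)) -> A (\prod_(i <- r | P i) F i).
Proof. by case: hA => A1 _ AM AF; apply: big_ind. Qed.

Lemma subring_setX x j : A x -> A (x ^+ j).
Proof.
by case: hA => A1 _ AM Ax; elim: j => [|j IHj]; rewrite ?expr0 ?exprS //; apply: AM.
Qed.

Lemma subring_set_sign j : A ((-1) ^+ j).
Proof. by apply: subring_setX; apply: subring_setN; case: hA. Qed.

Lemma subring_set_det j (M : 'M[S]_j) : (forall i i', A (M i i')) -> A (\det M).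
Proof.
case: (hA) => _ _ AM MA; apply: subring_set_sum => s _; apply: AM.
  exact: subring_set_sign.
by apply: subring_set_prod.
Qed.

Definition ideal_set (I : set S) := [/\ I 0, forall x y, I x -> I y -> I (x + y)
  & forall a x, A a -> I x -> I (a * x)].

Lemma ideal_gen_ideal (G : set S) : ideal_set (ideal_gen A G).
Proof.
case: (hA) => _ _ AM; split.
- by exists 0%N, (fun=> 0), (fun=> 0); split=> [[]//|]; rewrite big_ord0.
- move=> x y [m [a [s [As ->]]]] [m' [a' [s' [As' ->]]]].
  exists (m + m')%N, (fun i => match split i with inl i => a i | inr i => a' i end),
    (fun i => match split i with inl i => s i | inr i => s' i end); split.
    by move=> i; case: (split i).
  rewrite big_split_ord /=; congr (_ + _); apply: eq_bigr => i _.
    by rewrite (unsplitK (inl i)).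
  by rewrite (unsplitK (inr i)).
move=> b x Ab [m [a [s [As ->]]]]; exists m, (fun i => b * a i), s; split.
  by move=> i; case: (As i) => Aai ?; split=> //; apply: AM.
by rewrite mulr_sumr; apply: eq_bigr => i _; rewrite mulrA.
Qed.

Lemma ideal_gen_mem (G : set S) x : G x -> ideal_gen A G x.
Proof.
case: hA => A1 _ _ Gx; exists 1%N, (fun=> 1), (fun=> x); split=> //.
by rewrite big_ord1 mul1r.
Qed.

Lemma ideal_set_sum (J : set S) (I : Type) (r : seq I) (P : pred I) (F : I -> S) :
  ideal_set J -> (forall i, P i -> J (F i)) -> J (\sum_(i <- r | P i) F i).
Proof. by case=> J0 JD _ JF; apply: big_ind. Qed.

(* Laplace expansion along the last rows, obtained by developing the first rows
   one at a time. *)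
Lemma laplace_ideal (I : set S) d g (P : 'M[S]_(d, d + g)) (N : 'M[S]_(g, d + g)) :
    ideal_set I -> (forall i j, A (P i j)) ->
    (forall s : 'I_g -> 'I_(d + g), (forall i k : 'I_g, (i < k)%N -> (s i < s k)%N) ->
      I (\det (\matrix_(j, k) N j (s k)))) ->
  I (\det (col_mx P N)).
Proof.
move=> hI; elim: d => [|d IHd] in P N * => AP IN.
  have -> : col_mx P N = \matrix_(j, k) N j (id k).
    apply/matrixP => i j; rewrite !mxE /=; case: splitP => [[]//|k].
    by move=> ik; congr (N _ j); apply: ord_inj.
  exact: IN.
rewrite (expand_det_row _ (lshift g ord0)).
have [_ _ IM] := hI; apply: ideal_set_sum => // j _; apply: (IM).
  by rewrite col_mxEu.
apply: IM; first exact: subring_set_sign.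
have -> : row' (lshift g ord0) (col' j (col_mx P N)) =
    col_mx (row' ord0 (col' j P)) (col' j N) :> 'M_(d + g).
  apply/matrixP => i k; rewrite -(splitK i); case: (split i) => i' /=.
    rewrite col_mxEu !mxE.
    have -> : lift (lshift g ord0) (lshift g i') = lshift g (lift ord0 i') :> 'I_(d.+1 + g).
      exact: ord_inj.
    by rewrite (unsplitK (inl _)).
  rewrite col_mxEd !mxE.
  have -> : lift (lshift g ord0) (rshift d i') = rshift d.+1 i' :> 'I_(d.+1 + g).
    exact: ord_inj.
  by rewrite (unsplitK (inr _)).
apply: IHd => [i k|s smono]; first by rewrite !mxE.
rewrite (_ : (\matrix_(_, _) _) = \matrix_(i, k) N i (lift j (s k))).
  apply: IN => i k /smono ik; rewrite /= /bump; lia.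
by apply/matrixP => i k; rewrite !mxE.
Qed.

End Subrings.

(* Multiply [P; N] on the right by [W | (0; 1)]. *)
Lemma det_kernel_proportional (S : comNzRingType) d g (P : 'M[S]_(d, d + g))
    (N : 'M[S]_(g, d + g)) (W : 'M[S]_(d + g, d)) : N *m W = 0 ->
  \det (col_mx P N) * \det (usubmx W) = \det (P *m W) * \det (rsubmx N).
Proof.
move=> NW0.
have -> : \det (usubmx W) = \det (row_mx W (col_mx 0 1%:M)).
  by rewrite -{2}[W]vsubmxK -block_mxEh det_lblock det1 mulr1.
rewrite -det_mulmx mul_col_row NW0 -{2}[P]hsubmxK -{1}[N]hsubmxK !mul_row_col.
by rewrite !mulmx0 !add0r !mulmx1 det_ublock.
Qed.

(** * Convergence *)

Section Norms.
Variables (R : realType).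
Local Notation C := R[i].
Implicit Types (r b : C) (N : nat).

(** A partial sum of the weighted l1 norm at radius [r]. Convergence becomes a bound uniform in [N],
    and no infinite sum has to be handled. *)
Definition fps_norm k N r (f : fps C k) :=
  \sum_(a : 'X_{1..k < N}) `|f a| * r ^+ mdeg a.

Lemma ler_sum_bmnm k N (s : seq 'X_{1..k}) (G : 'X_{1..k} -> C) :
    (forall a, 0 <= G a) -> uniq s -> (forall a, a \in s -> (mdeg a < N)%N) ->
  \sum_(a <- s) G a <= \sum_(a : 'X_{1..k < N}) G a.
Proof.
move=> G0 us sN; rewrite (@big_mksub _ _ _ _ _ 'X_{1..k < N}) // [leLHS]big_mkcond.
by apply: ler_sum => a _; case: ifP.
Qed.

Section NormTheory.
Variable k : nat.
Implicit Types f h : fps C k.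

Lemma fps_norm_ge0 N r f : 0 <= r -> 0 <= fps_norm N r f.
Proof. by move=> r0; apply: sumr_ge0 => a _; rewrite mulr_ge0 ?exprn_ge0. Qed.

Lemma fps_norm_le N r r' f : 0 <= r -> r <= r' -> fps_norm N r f <= fps_norm N r' f.
Proof.
move=> r0 rr'; apply: ler_sum => a _; rewrite ler_wpM2l //.
by rewrite lerXn2r // nnegrE (le_trans r0).
Qed.

Lemma convergentP f :
  convergent f <-> exists r b, 0 < r /\ forall N, fps_norm N r f <= b.
Proof.
split=> -[r [b [r0 fb]]]; exists r, b; split=> //.
  move=> N; have := fb (map (@bmnm k N) (enum {: 'X_{1..k < N}})).
  rewrite big_map big_enum /=; apply; rewrite map_inj_uniq ?enum_uniq //.
  exact: val_inj.
move=> s us; pose N := (\max_(a <- s) mdeg a).+1.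
apply: le_trans (fb N); apply: ler_sum_bmnm => // [a|a sa].
  by rewrite mulr_ge0 // exprn_ge0 // ltW.
by rewrite ltnS; apply: leq_bigmax_seq.
Qed.

Lemma fps_normD N r f h : 0 <= r -> fps_norm N r (f + h) <= fps_norm N r f + fps_norm N r h.
Proof.
move=> r0; rewrite -big_split; apply: ler_sum => a _ /=.
by rewrite -mulrDl ler_wpM2r ?exprn_ge0 ?ler_normD.
Qed.

Lemma fps_normN N r f : fps_norm N r (- f) = fps_norm N r f.
Proof. by apply: eq_bigr => a _; rewrite coefsN normrN. Qed.

Lemma fps_norm_mon N r (c : C) (m : 'X_{1..k}) : 0 <= r ->
  fps_norm N r (fps_mon c m) <= `|c| * r ^+ mdeg m.
Proof.
move=> r0; have [mN|Nm] := ltnP (mdeg m) N.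
  rewrite /fps_norm (bigD1 (BMultinom mN)) //= eqxx mulr1n big1 ?addr0 // => a.
  by rewrite bmeqP /= => /negbTE ->; rewrite mulr0n normr0 mul0r.
rewrite [leLHS]big1 ?mulr_ge0 ?exprn_ge0 // => a _; rewrite coefs_mon.
case: eqP => [am|_]; last by rewrite mulr0n normr0 mul0r.
by have := bmdeg a; rewrite am ltnNge Nm.
Qed.

Lemma fps_norm1 N r : 0 <= r -> fps_norm N r (1 : fps C k) <= 1.
Proof.
move=> r0; have := @fps_norm_mon N r 1 0%MM r0.
by rewrite fps_mon1 mdeg0 normr1 mulr1.
Qed.

(** A divisor of a monomial of degree below [N] also has degree below [N], so the truncated norms
    are already submultiplicative. *)
Lemma fps_normM N r f h : 0 <= r ->
  fps_norm N r (f * h) <= fps_norm N r f * fps_norm N r h.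
Proof.
move=> r0; pose G f (a : 'X_{1..k}) := `|(f : fps C k) a| * r ^+ mdeg a.
have G0 f' a : 0 <= G f' a by rewrite mulr_ge0 ?exprn_ge0.
apply: (@le_trans _ _ (\sum_(a : 'X_{1..k < N}) \sum_(b : 'X_{1..k < N} | (b <= a)%MM)
   G f b * G h (a - b)%MM)).
  apply: ler_sum => a _; rewrite (coefsM _ _ (bmdeg a)).
  apply: (@le_trans _ _ (\sum_(b : 'X_{1..k < N} | (b <= a)%MM)
      `|f b * h (a - b)%MM| * r ^+ mdeg a)).
    by rewrite -mulr_suml ler_wpM2r ?exprn_ge0 // ler_norm_sum.
  apply: ler_sum => b ba; rewrite normrM /G mulrACA -exprD -mdegD.
  by rewrite addmC submK.
rewrite (exchange_big_dep xpredT) //= /fps_norm mulr_suml; apply: ler_sum => b _.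
rewrite -mulr_sumr; apply: ler_wpM2l; first exact: G0.
(* The exponents [a - b] are distinct and of degree below [N], so their sum is part of the norm of
   [h]. *)
pose s := [seq (a - b)%MM | a : 'X_{1..k < N} <- enum {: 'X_{1..k < N}} & (b <= a)%MM].
suff -> : \sum_(a : 'X_{1..k < N} | (b <= a)%MM) G h (a - b)%MM = \sum_(a <- s) G h a.
  apply: ler_sum_bmnm; first exact: G0.
    rewrite map_inj_in_uniq; first exact/filter_uniq/enum_uniq.
    move=> a a'; rewrite !mem_filter => /andP[ba _] /andP[ba' _] eqa; apply: val_inj => /=.
    by rewrite -(submK ba) eqa submK.
  by move=> a /mapP[a' _ ->]; rewrite (leq_ltn_trans (mdegB _ _)) ?bmdeg.
by rewrite big_map big_filter big_enum_cond.
Qed.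

Lemma fps_normX N r j f : 0 <= r -> fps_norm N r (f ^+ j) <= fps_norm N r f ^+ j.
Proof.
move=> r0; elim: j => [|j IHj]; first by rewrite !expr0 fps_norm1.
rewrite !exprS (le_trans (fps_normM _ _ _ r0)) // ler_wpM2l //.
exact: fps_norm_ge0.
Qed.

Lemma fps_norm_prod N r (I : finType) (F : I -> fps C k) : 0 <= r ->
  fps_norm N r (\prod_i F i) <= \prod_i fps_norm N r (F i).
Proof.
move=> r0; elim/big_rec2: _ => [|i x f _ fx]; first exact: fps_norm1.
by rewrite (le_trans (fps_normM _ _ _ r0)) // ler_wpM2l // fps_norm_ge0.
Qed.

End NormTheory.

(** A property valid at all sufficiently small radii: finitely many of them hold at a common
    radius. *)
Definition small (P : C -> Prop) :=
  exists2 r0 : C, 0 < r0 & forall r, 0 < r -> r <= r0 -> P r.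

Lemma small_and P Q : small P -> small Q -> small (fun r => P r /\ Q r).
Proof.
move=> [r1 r10 P1] [r2 r20 Q2]; have r12 : 0 < r1 + r2 by rewrite addr_gt0.
(* A positive number below both [r1] and [r2], found without comparing them in the partial order of
   [R[i]]. *)
exists (r1 * r2 / (r1 + r2)); first by rewrite divr_gt0 ?mulr_gt0.
move=> r r0 rle; split; [apply: P1 => //|apply: Q2 => //]; apply: (le_trans rle).
  by rewrite ler_pdivrMr // ler_pM2l // lerDr ltW.
by rewrite ler_pdivrMr // mulrC ler_pM2l // lerDl ltW.
Qed.

Lemma small_all (I : finType) (P : I -> C -> Prop) :
  (forall i, small (P i)) -> small (fun r => forall i, P i r).
Proof.
move=> sP; suff [r0 r00 Pr0] : small (fun r => forall i, i \in enum I -> P i r).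
  by exists r0 => // r rpos /(Pr0 r rpos) Pr i; apply: Pr; rewrite mem_enum.
elim: (enum I) => [|i s [r0 r00 IHs]]; first by exists 1.
have [r1 r10 Pr1] := small_and (sP i) (ex_intro2 _ _ r0 r00 IHs).
exists r1 => // r rpos /(Pr1 r rpos)[Pi Ps] j; rewrite inE => /orP[/eqP -> //|].
exact: Ps.
Qed.

Lemma small_get P : small P -> exists2 r, 0 < r & P r.
Proof. by case=> r0 r00 Pr0; exists r0 => //; apply: Pr0. Qed.

Lemma convergent_small k (f : fps C k) :
  convergent f -> exists b, small (fun r => forall N, fps_norm N r f <= b).
Proof.
move=> /convergentP[r0 [b [r00 fb]]]; exists b, r0 => // r rpos rr0 N.
by apply: le_trans (fb N); apply: fps_norm_le => //; apply: ltW.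
Qed.

Lemma convergent_small0 k (f : fps C k) e : convergent f -> f 0%MM = 0 -> 0 < e ->
  small (fun r => forall N, fps_norm N r f <= e).
Proof.
move=> /convergentP[r0 [b [r00 fb]]] f0 epos.
have b0 : 0 <= b by apply: le_trans (fb 0%N); rewrite fps_norm_ge0 // ltW.
have eb : 0 < e + b by rewrite ltr_wpDr.
(* The ratio satisfies t <= 1 and t b <= e. As [f] has no constant term, passing from radius [r0] to
   [t * r0] multiplies its norm by at most [t]. *)
pose t := e / (e + b); have t0 : 0 < t by rewrite divr_gt0.
have t1 : t <= 1 by rewrite ler_pdivrMr // mul1r lerDl.
exists (t * r0); first by rewrite mulr_gt0.
move=> r rpos rle N; apply: (@le_trans _ _ (t * fps_norm N r0 f)); last first.
  rewrite (le_trans (ler_wpM2l (ltW t0) (fb N))) // mulrAC ler_pdivrMr //.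
  by rewrite ler_pM2l // lerDr ltW.
apply: le_trans (fps_norm_le _ _ (ltW rpos) rle) _.
rewrite /fps_norm mulr_sumr; apply: ler_sum => a _.
have [->|a0] := eqVneq (a : 'X_{1..k}) 0%MM; first by rewrite f0 normr0 !mul0r mulr0.
rewrite mulrCA ler_wpM2l // exprMn ler_wpM2r ?exprn_ge0 ?(ltW r00) //.
rewrite -mdeg_eq0 -lt0n in a0; rewrite -(prednK a0) exprS ler_piMr ?(ltW t0) //.
by rewrite exprn_ile1 // ltW.
Qed.

Lemma convergent1 k : convergent (1 : fps C k).
Proof. by apply/convergentP; exists 1, 1; split=> // N; apply: fps_norm1. Qed.

Lemma convergent_mon k (c : C) (m : 'X_{1..k}) : convergent (fps_mon c m).
Proof.
apply/convergentP; exists 1, `|c|; split=> // N.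
by have := @fps_norm_mon k N 1 c m ler01; rewrite expr1n mulr1.
Qed.

Lemma convergentB k (f h : fps C k) : convergent f -> convergent h -> convergent (f - h).
Proof.
move=> /convergent_small[b sf] /convergent_small[b' sh].
have [r r0 [fb hb]] := small_get (small_and sf sh).
apply/convergentP; exists r, (b + b'); split=> // N.
by rewrite (le_trans (fps_normD _ _ _ (ltW r0))) // fps_normN lerD.
Qed.

Lemma convergentM k (f h : fps C k) : convergent f -> convergent h -> convergent (f * h).
Proof.
move=> /convergent_small[b sf] /convergent_small[b' sh].
have [r r0 [fb hb]] := small_get (small_and sf sh).
apply/convergentP; exists r, (b * b'); split=> // N.
by rewrite (le_trans (fps_normM _ _ _ (ltW r0))) // ler_pM ?fps_norm_ge0 ?(ltW r0).
Qed.

Lemma convergent_shift k (f : fps C k) m :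
  convergent f -> convergent (Fps (fun a => f (m + a)%MM)).
Proof.
move=> /convergentP[r [b [r0 fb]]]; apply/convergentP; exists r, (b / r ^+ mdeg m).
split=> // N; rewrite ler_pdivlMr ?exprn_gt0 //.
apply: le_trans (fb (mdeg m + N)%N).
rewrite /fps_norm mulr_suml.
pose s := [seq (m + a)%MM | a : 'X_{1..k < N} <- enum {: 'X_{1..k < N}}].
have -> : \sum_(a : 'X_{1..k < N})
      `|Fps (fun a => f (m + a)%MM) a| * r ^+ mdeg a * r ^+ mdeg m =
    \sum_(a <- s) `|f a| * r ^+ mdeg a.
  rewrite big_map big_enum; apply: eq_bigr => a _ /=.
  by rewrite -mulrA -exprD -mdegD addmC.
apply: (@ler_sum_bmnm _ _ _ (fun a => `|f a| * r ^+ mdeg a)).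
- by move=> a; rewrite mulr_ge0 ?exprn_ge0 ?(ltW r0).
- rewrite map_inj_uniq ?enum_uniq // => a a' eqa; apply: val_inj => /=.
  by rewrite -[LHS](addmK m) addmC eqa addmC addmK.
by move=> a /mapP[a' _ ->]; rewrite mdegD ltn_add2l bmdeg.
Qed.

(** Up to the factor a_i + 1, a derivative is a shift of the coefficients; halving the radius
    absorbs this factor, since a_i + 1 <= 2^{a_i} <= 2^{|a|}. *)
Lemma convergent_deriv k (f : fps C k) i : convergent f -> convergent (fps_deriv i f).
Proof.
move=> /(@convergent_shift _ _ U_(i)%MM) /convergentP[r [b [r0 fb]]].
apply/convergentP; exists (r / 2), b; split; first by rewrite divr_gt0.
move=> N; apply: le_trans (fb N); apply: ler_sum => a _ /=.
rewrite normrMn [(a + _)%MM]addmC mulrnAl -mulrnAr ler_wpM2l //.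
rewrite exprMn exprVn -mulr_natr -mulrA -[leRHS]mulr1.
rewrite ler_wpM2l ?exprn_ge0 ?(ltW r0) // mulrC.
rewrite ler_pdivrMr ?exprn_gt0 // mul1r -natrX ler_nat.
apply: (@leq_trans (2 ^ a i)%N); first exact: ltn_expl.
by rewrite leq_exp2l // mdegE (bigD1 i) //= leq_addr.
Qed.

(** At a radius where every [z i] has norm at most [r], the norm of z^a is at most r^{|a|}, so that
    the norm of [F] at [r] bounds that of the composite. *)
Lemma convergent_eval k d (F : fps C k) (z : 'I_k -> fps C d) :
    (forall i, convergent (z i) /\ z i 0%MM = 0) -> convergent F ->
  convergent (fps_eval F z).
Proof.
move=> hz /convergentP[r [b [r0 Fb]]].
have z0 i : z i 0%MM = 0 by case: (hz i).
have zc i : convergent (z i) by case: (hz i).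
have [r' r'0 zr] := small_get (small_all (fun i => convergent_small0 (zc i) (z0 i) r0)).
have r'ge0 := ltW r'0.
apply/convergentP; exists r', b; split=> // N; apply: le_trans (Fb N).
apply: (@le_trans _ _ (\sum_(a : 'X_{1..k < N}) `|F a| * fps_norm N r' (zmon z a))).
  under eq_bigr => a _ do rewrite mulr_sumr.
  rewrite exchange_big; apply: ler_sum => c _.
  rewrite (coefs_evalE z0 _ (bmdeg c)).
  under [leRHS]eq_bigr => a _ do rewrite mulrA -normrM.
  by rewrite -mulr_suml ler_wpM2r ?exprn_ge0 // ler_norm_sum.
apply: ler_sum => a _; rewrite ler_wpM2l // (le_trans (fps_norm_prod _ _ r'ge0)) //.
rewrite mdegE -prodrXr; apply: ler_prod => i _; rewrite fps_norm_ge0 //=.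
rewrite (le_trans (fps_normX _ _ _ r'ge0)) // lerXn2r // nnegrE ?fps_norm_ge0 //.
exact: ltW.
Qed.

End Norms.

(** * Units, and rings of convergent series with exponents in a subgroup *)

Section Inverse.
Variables (K : fieldType) (d : nat).
Implicit Types (y u v : fps K d).

(** Substitute [y] into the one-variable series G with all coefficients 1, which satisfies G = 1 + U
    G. *)
Lemma geometric_series y : y 0%MM = 0 -> exists w, w = 1 + y * w.
Proof.
move=> y0; pose z (i : 'I_1) := y; have z0 i : z i 0%MM = 0 by [].
pose G : fps K 1 := Fps (fun=> 1).
have GE : G = 1 + fps_mon 1 U_(ord0)%MM * G.
  apply: fpsP => a; rewrite coefsD coefs1; have [->|a0] := eqVneq a 0%MM.
    by rewrite coefsM0 coefs_mon eq_sym mnm1_eq0 mulr0n mul0r addr0.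
  rewrite add0r -[a in RHS](@submK _ U_(ord0)%MM).
    by rewrite addmC coefs_monM mul1r.
  apply/mnm_lepP => i; rewrite (ord1 i) mnm1E eqxx lt0n; apply: contraNneq a0 => a0.
  by apply/eqP/mnmP => j; rewrite (ord1 j) a0 mnm0E.
exists (evalz z0 G); rewrite {1}GE rmorphD rmorph1 rmorphM /=.
by rewrite eval_var.
Qed.

Lemma fps_invertible u : u 0%MM != 0 -> exists v, u * v = 1.
Proof.
move=> u0; pose y := 1 - fpsC d (u 0%MM)^-1 * u.
have y0 : y 0%MM = 0.
  by rewrite /y coefsD coefsN coefs_fpsCM mulVf // coefs1 eqxx subrr.
have [w wE] := geometric_series y0; exists (fpsC d (u 0%MM)^-1 * w).
rewrite mulrCA mulrA -[fpsC _ _ * u](subKr 1) -/y mulrBl mul1r {1}wE.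
by rewrite addrK.
Qed.

End Inverse.

Section PowerSeriesRing.
Variables (R : realType) (d n : nat) (L : set 'rV[rat]_d).
Local Notation C := R[i].
Hypotheses (L0 : L 0) (LB : forall x y, L x -> L y -> L (x - y)).

Lemma expoD a b : expo n (a + b)%MM = expo n a + expo n b :> 'rV_d.
Proof. by apply/rowP => i; rewrite !mxE mnmDE natrD mulrDl. Qed.

Lemma expo0 : expo n 0%MM = 0 :> 'rV_d.
Proof. by apply/rowP => i; rewrite !mxE mnm0E mul0r. Qed.

Lemma subgroupD x y : L x -> L y -> L (x + y).
Proof.
by move=> Lx Ly; rewrite -[y]opprK; apply: LB => //; rewrite -sub0r; apply: LB.
Qed.

Lemma subgroupMn x j : L x -> L (x *+ j).
Proof. by move=> Lx; elim: j => [|j IHj]; rewrite ?mulr0n // mulrS; apply: subgroupD. Qed.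

Lemma pser_subring : subring_set (@pser R d n L).
Proof.
split=> [|f h [fc fL] [hc hL]|f h [fc fL] [hc hL]].
- split; first exact: convergent1.
  move=> a; rewrite coefs1.
  by case: (eqVneq a 0%MM) => [-> _|_]; rewrite ?expo0 // mulr0n eqxx.
- split; first exact: convergentB.
  move=> a; rewrite coefsD coefsN; have [->|/fL//] := eqVneq (f a) 0.
  by rewrite sub0r oppr_eq0 => /hL.
split; first exact: convergentM.
by move=> a /coefsM_neq0[b [b' [-> /fL Lb /hL Lb']]]; rewrite expoD; apply: subgroupD.
Qed.

Lemma pser_mon (c : C) a : L (expo n a) -> pser n L (fps_mon c a).
Proof.
by move=> La; split=> [|b /coefs_mon_neq0 -> //]; first exact: convergent_mon.
Qed.

Lemma pser_eval k (F : fps C k) (z : 'I_k -> fps C d) :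
    (forall i, pser n L (z i) /\ z i 0%MM = 0) -> convergent F ->
  pser n L (fps_eval F z).
Proof.
move=> hz Fc; split.
  by apply: convergent_eval => // i; case: (hz i) => -[].
move=> b /coefs_eval_neq0[a _]; suff [_ ] : pser n L (zmon z a) by apply.
apply: (subring_set_prod pser_subring) => i _.
by apply: (subring_setX pser_subring); case: (hz i).
Qed.

Lemma pser_shift (f : fps C d) m : L (expo n m) -> pser n L f ->
  pser n L (Fps (fun a => f (m + a)%MM)).
Proof.
move=> Lm [fc fL]; split; first exact: convergent_shift.
move=> a /fL; rewrite expoD => Lma; rewrite -[expo n a](addKr (expo n m)) addrC.
exact: LB.
Qed.

Lemma pser_inv (u : fps C d) : pser n L u -> u 0%MM != 0 ->
  exists2 v, pser n L v & u * v = 1.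
Proof.
move=> uL u0; have [_ pB pM] := pser_subring; have [p1 _ _] := pser_subring.
pose c := fpsC d (u 0%MM)^-1; have pc : pser n L c by apply: pser_mon; rewrite expo0.
have [v uv] := fps_invertible u0; exists v => //.
pose y := 1 - c * u; have y0 : y 0%MM = 0.
  by rewrite /y coefsD coefsN coefs_fpsCM mulVf // coefs1 eqxx subrr.
have py : pser n L y by apply: (pB) => //; apply: (pM).
have vE : v = c + y * v by rewrite mulrBl mul1r -mulrA uv mulr1 addrC subrK.
case: (py) => yc yL; split.
  (* [v = c + y v] with [y] of norm at most 1/2, so that [v] has norm at most 2 |c|. *)
  have half : 0 < 2^-1 :> C by rewrite invr_gt0.
  have [r r0 yr] := small_get (convergent_small0 yc y0 half).
  apply/convergentP; exists r, (2 * `|(u 0%MM)^-1|); split=> // N.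
  have := fps_normD N c (y * v) (ltW r0); rewrite -vE => vle.
  have cle := @fps_norm_mon _ d N r (u 0%MM)^-1 0%MM (ltW r0).
  rewrite mdeg0 mulr1 in cle.
  have yvle : fps_norm N r (y * v) <= 2^-1 * fps_norm N r v.
    rewrite (le_trans (fps_normM _ _ _ (ltW r0))) // ler_wpM2r ?yr //.
    by rewrite fps_norm_ge0 // ltW.
  have := le_trans vle (lerD cle yvle); rewrite -lerBlDr.
  have -> : fps_norm N r v - 2^-1 * fps_norm N r v = fps_norm N r v / 2.
    by rewrite {1}(splitr (fps_norm N r v)) [2^-1 * _]mulrC addrK.
  by rewrite ler_pdivrMr // mulrC.
(* Support of [v], by induction on the degree: [y] has no constant term, so a coefficient of [y * v]
   involves only coefficients of [v] of smaller degree. *)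
move=> a; move: {2}(mdeg a) (leqnn (mdeg a)) => j; elim: j a => [|j IHj] a.
  by rewrite leqn0 mdeg_eq0 => /eqP -> _; rewrite expo0.
move=> aj; rewrite vE coefsD; have [c0|c0 _] := eqVneq (c a) 0; last by case: pc => _; apply.
rewrite c0 add0r => /coefsM_neq0[b [b' [ab yb vb']]]; rewrite ab expoD.
apply: subgroupD; first exact: yL.
apply: IHj vb'; move: aj; rewrite ab mdegD.
have : mdeg b != 0%N by rewrite mdeg_eq0; apply: contraNneq yb => ->; rewrite y0.
by rewrite -lt0n; lia.
Qed.

End PowerSeriesRing.

(** * Orders of the solutions of an overweight system *)

Section WeightedDegree.
Variables (d : nat) (w : 'I_d -> nat).
Implicit Types a b : 'X_{1..d}.

Definition wdeg a := (\sum_i w i * a i)%N.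

Lemma wdegD a b : wdeg (a + b)%MM = (wdeg a + wdeg b)%N.
Proof. by rewrite -big_split; apply: eq_bigr => i _; rewrite mnmDE mulnDr. Qed.

Lemma wdegMn a j : wdeg (a *+ j)%MM = (wdeg a * j)%N.
Proof. by rewrite big_distrl; apply: eq_bigr => i _; rewrite mulmnE mulnA. Qed.

Lemma wdeg_sum (I : finType) (F : I -> 'X_{1..d}) :
  wdeg (\sum_i F i)%MM = (\sum_i wdeg (F i))%N.
Proof.
apply: (big_morph wdeg wdegD); rewrite /wdeg big1 // => i _.
by rewrite mnm0E muln0.
Qed.

Hypothesis w_gt0 : forall i, (0 < w i)%N.

Lemma wdeg_gt0 a : a != 0%MM -> (0 < wdeg a)%N.
Proof.
rewrite lt0n; apply: contraNneq => /eqP; rewrite sum_nat_eq0 => /forallP wa0.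
apply/eqP/mnmP => i; rewrite mnm0E; apply/eqP.
by have := wa0 i; rewrite muln_eq0 -[w i == _]negbK -lt0n w_gt0.
Qed.

Lemma ltn_wdeg a b : (a <= b)%MM -> a != b -> (wdeg a < wdeg b)%N.
Proof.
move=> ab ne; rewrite -(submK ab) wdegD -[X in (X < _)%N]add0n ltn_add2r wdeg_gt0 //.
by apply: contraNneq ne => ba0; rewrite -(submK ab) ba0 add0m.
Qed.

End WeightedDegree.

Lemma coefs_eulerE (K : fieldType) k (F : fps K k) (i : 'I_k) :
  fps_mon 1 U_(i)%MM * fps_deriv i F = Fps (fun a => F a *+ a i).
Proof.
apply: fpsP => a; rewrite [RHS]/=; have [ai|ai] := eqVneq (a i) 0%N.
  rewrite ai mulr0n; apply/eqP; apply: contraT => /coefs_monM_neq0.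
  by move=> /mnm_lepP/(_ i); rewrite mnm1E eqxx ai.
have Ua : (U_(i) <= a)%MM.
  by apply/mnm_lepP => j; rewrite mnm1E; case: eqP => // <-; rewrite lt0n.
rewrite -{1}(submK Ua) addmC coefs_monM mul1r /= submK //.
by rewrite mnmBE mnm1E eqxx subn1 prednK ?lt0n.
Qed.

Section OverweightSystem.
Variables (K : fieldType) (d g : nat).
Variables (z : 'I_(d + g) -> fps K d) (z0 : forall i, z i 0%MM = 0).
Variables (q : 'I_(d + g) -> 'X_{1..d}) (nn : 'I_g -> nat).
Variables (ell : 'I_g -> 'X_{1..d + g}) (T : 'I_g -> fps K (d + g)).
Local Notation ev := (evalz z0).

(** The weight of U^a when U_i has weight [q i]. For [q i] equal to n gamma_i, this is n times
    [psi]. *)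
Definition qdeg (a : 'X_{1..d + g}) : 'X_{1..d} := (\sum_i q i *+ a i)%MM.

Definition system j : fps K (d + g) :=
  fps_mon 1 (ell j) - fps_mon 1 (U_(rshift d j) *+ nn j)%MM + T j.

(** The common weight of the two monomials of the binomial of index [j], by [qdeg_ell]. *)
Definition mu j := (q (rshift d j) *+ nn j)%MM.

Hypothesis charK : [pchar K] =i pred0.
Hypothesis z_var : forall i : 'I_d, z (lshift g i) = fps_mon 1 (q (lshift g i)).
Hypothesis q_neq0 : forall i, q i != 0%MM.
Hypothesis nn_gt0 : forall j, (0 < nn j)%N.
Hypothesis ell_lt : forall (j : 'I_g) (i : 'I_(d + g)), (d + j <= i)%N -> ell j i = 0%N.
Hypothesis qdeg_ell : forall j, qdeg (ell j) = mu j.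
Hypothesis T_over : forall j a, T j a != 0 -> (mu j <= qdeg a)%MM /\ mu j != qdeg a.
Hypothesis system0 : forall j, ev (system j) = 0.

Lemma qdegU i j : qdeg (U_(i) *+ j)%MM = (q i *+ j)%MM.
Proof.
rewrite /qdeg (bigD1 i) //= mulmnE mnm1E eqxx mul1n.
apply/mnmP => l; rewrite mnmDE mnm_sumE big1 ?addn0 // => i' /negbTE i'i.
by rewrite !mulmnE mnm1E eq_sym i'i mul0n muln0.
Qed.

Lemma zmonUn i j : zmon z (U_(i) *+ j)%MM = z i ^+ j.
Proof.
rewrite /zmon (bigD1 i) //= mulmnE mnm1E eqxx mul1n big1 ?mulr1 // => l /negbTE li.
by rewrite mulmnE mnm1E eq_sym li.
Qed.

Lemma eval_system j :
  ev (system j) = zmon z (ell j) - z (rshift d j) ^+ nn j + ev (T j).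
Proof.
by rewrite rmorphD rmorphB /= !eval_mon rmorph1 !mul1r zmonUn.
Qed.

Lemma mu_neq0 j : mu j != 0%MM.
Proof.
apply: contraNneq (q_neq0 (rshift d j)) => /mnmP mu0; apply/eqP/mnmP => i.
have /eqP := mu0 i; rewrite mulmnE mnm0E muln_eq0 => /orP[/eqP //|].
by rewrite -[_ == _]negbK -lt0n nn_gt0.
Qed.

(* Among all the monomials of all the [z i], take one whose weight is smallest
   relatively to that of [q i], with [i] minimal. If this ratio were less than 1,
   then in the equation [system j] the initial form of [z (rshift d j) ^+ nn j]
   could not be cancelled. *)
Lemma ord_ge_wdeg (w : 'I_d -> nat) : (forall i, (0 < w i)%N) ->
  forall i, ord_ge (wdeg w) (wdeg w (q i)) (z i).
Proof.
move=> w0 i1 a1 za1; rewrite leqNgt; apply/negP => lt1.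
pose b i := wdeg w (q i); have b0 i : (0 < b i)%N by rewrite wdeg_gt0.
pose P := (\prod_i b i)%N.
have bP i : (b i %| P)%N by rewrite /P (bigD1 i) //= dvdn_mulr.
have P0 : (0 < P)%N by rewrite prodn_gt0.
(* An integer encoding the lexicographic order on the pairs (ratio, index): [P] is a common
   denominator of the ratios [wdeg w a / b i], and [i < d + g] breaks ties. *)
pose key i a := ((wdeg w a * (P %/ b i)) * (d + g) + (i : 'I_(d + g)))%N.
pose keys m := `[< exists i a, z i a != 0 /\ key i a = m >].
have exk : exists m, keys m by exists (key i1 a1); apply/asboolP; exists i1, a1.
case: (ex_minnP exk) => m /asboolP[i0 [a0 [za0 <-]]] kmin.
have le_key i a : z i a != 0 -> (key i0 a0 <= key i a)%N.
  by move=> za; apply: kmin; apply/asboolP; exists i, a.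
set A := wdeg w a0.
have cross i a : (A * (P %/ b i0) * (b i * b i0) = A * b i * P)%N /\
   (wdeg w a * (P %/ b i) * (b i * b i0) = b i0 * wdeg w a * P)%N.
  by split; [rewrite -[in RHS](divnK (bP i0))|rewrite -[in RHS](divnK (bP i))]; ring.
have bb0 i : (0 < b i * b i0)%N by rewrite muln_gt0 !b0.
have ratio i : ord_ge (fun a => (b i0 * wdeg w a)%N) (A * b i) (z i).
  move=> a /le_key kle; rewrite -(leq_pmul2r P0).
  have [<- <-] := cross i a; rewrite leq_pmul2r //.
  rewrite -ltnS -(ltn_pmul2r (leq_ltn_trans (leq0n _) (ltn_ord i0))).
  rewrite -/A /key in kle; have := ltn_ord i; rewrite mulSn; lia.
(* Before [i0] a tie of ratios would give a smaller key, so the inequality is strict there. *)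
have ratio_lt (i : 'I_(d + g)) : (i < i0)%N ->
    ord_ge (fun a => (b i0 * wdeg w a)%N) (A * b i).+1 (z i).
  move=> ii0 a /le_key kle; rewrite -(ltn_pmul2r P0).
  have [<- <-] := cross i a; rewrite ltn_pmul2r //.
  rewrite -(ltn_pmul2r (leq_ltn_trans (leq0n _) (ltn_ord i0))).
  rewrite -/A /key in kle; lia.
have A_lt : (A < b i0)%N.
  have := ratio i1 a1 za1; rewrite -(ltn_pmul2r (b0 i1)) => /leq_ltn_trans; apply.
  by rewrite ltn_pmul2l.
have A0 : (0 < A)%N by rewrite wdeg_gt0 //; apply: contraNneq za0 => ->; rewrite z0.
case: (splitP i0) => [i ii0|j ji0].
  have i0E : i0 = lshift g i by apply: ord_inj.
  move: za0 A_lt; rewrite /A /b i0E z_var => /coefs_mon_neq0 ->.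
  by rewrite ltnn.
have i0E : i0 = rshift d j by apply: ord_inj.
pose w' a := (b i0 * wdeg w a)%N.
have w'D a a' : w' (a + a')%MM = (w' a + w' a')%N by rewrite /w' wdegD mulnDr.
have [c w'c zc] : exists2 c, w' c = (A * b i0 * nn j)%N & (z i0 ^+ nn j) c != 0.
  by apply: (ordX_attained w'D _ (ratio i0) za0); rewrite /w' mulnC.
have wq (a : 'X_{1..d + g}) : (\sum_i A * b i * a i = A * wdeg w (qdeg a))%N.
  rewrite wdeg_sum big_distrr; apply: eq_bigr => i _ /=.
  by rewrite wdegMn mulnA.
have wmu : (A * b i0 * nn j = A * wdeg w (mu j))%N by rewrite wdegMn mulnA i0E.
have /eqP := congr1 (fun f : fps K d => f c) (system0 j).
rewrite eval_system !coefsD coefsN -i0E.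
(* All variables in [ell j] precede [i0], so [ratio_lt] puts this product strictly above the weight
   of [c]; some variable does occur, because [mu j] is nonzero. *)
have -> : zmon z (ell j) c = 0.
  apply/eqP; apply: contraT => zell; exfalso.
  have elt i : ell j i != 0%N -> ord_ge w' (A * b i).+1 (z i).
    move=> elli; apply: ratio_lt; rewrite ltnNge; apply: contra_neqN elli => i0i.
    by rewrite ell_lt // -ji0.
  have := ord_ge_zmon w'D elt zell; rewrite w'c.
  under eq_bigr do rewrite mulSn.
  rewrite big_split /= wq qdeg_ell wmu -mdegE.
  rewrite -[X in (_ <= X)%N]add0n leq_add2r leqn0 mdeg_eq0 => /eqP ell0.
  case/eqP: (mu_neq0 j); rewrite -qdeg_ell ell0 /qdeg.
  by apply/mnmP => i; rewrite mnm_sumE big1 ?mnm0E // => l _; rewrite mulmnE mnm0E muln0.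
have -> : ev (T j) c = 0.
  apply/eqP; apply: contraT => /(coefs_eval_neq0)[a /T_over[mua muna] zac]; exfalso.
  have := @ord_ge_zmon _ _ _ z w' (fun i => (A * b i)%N) a w'D (fun i _ => ratio i) c zac.
  rewrite w'c wq wmu leq_pmul2l // leqNgt => /negP; apply.
  exact: ltn_wdeg.
by rewrite addr0 sub0r oppr_eq0; apply/negP.
Qed.

(** If a_l < q_l for some l, the weight 1 + |a| on coordinate l and 1 elsewhere contradicts
    [ord_ge_wdeg]: [a] then weighs |a| (1 + a_l), less than (1 + |a|) q_l, which is at most the
    weight of [q i]. *)
Lemma coefs_z_neq0 i a : z i a != 0 -> (q i <= a)%MM.
Proof.
move=> za; apply/mnm_lepP => l; rewrite leqNgt; apply/negP => lt_al.
pose w l' := (1 + mdeg a * (l' == l))%N.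
have : (wdeg w (q i) <= wdeg w a)%N by apply: (ord_ge_wdeg (w := w)) za.
apply/negP; rewrite -ltnNge.
have -> : wdeg w a = (mdeg a + mdeg a * a l)%N.
  rewrite /wdeg /w; under eq_bigr do rewrite mulnDl mul1n.
  rewrite big_split /= -mdegE (bigD1 l) //= eqxx muln1 big1 ?addn0 // => l' /negbTE ->.
  by rewrite muln0.
apply: (@leq_trans ((1 + mdeg a) * q i l)).
  by apply: (@leq_trans ((1 + mdeg a) * (a l).+1)); [lia|rewrite leq_mul2l lt_al orbT].
by rewrite /wdeg (bigD1 l) //= /w eqxx muln1 leq_addr.
Qed.

Definition zred i : fps K d := Fps (fun a => z i (q i + a)%MM).

Lemma z_factor i : z i = fps_mon 1 (q i) * zred i.
Proof. by apply: fps_factor => a; apply: coefs_z_neq0. Qed.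

Lemma zmon_factor a : zmon z a = fps_mon 1 (qdeg a) * zmon zred a.
Proof.
rewrite /zmon /qdeg -fps_mon_prod -big_split; apply: eq_bigr => i _ /=.
by rewrite {1}z_factor exprMn fps_monX.
Qed.

(** Monomials of weight strictly above [mu j] cannot reach the exponent [mu j]. Stating this for any
    [F] supported in [T j] also covers the Euler derivatives of [T j]. *)
Lemma eval_T_mu j (F : fps K (d + g)) : (forall a, F a != 0 -> T j a != 0) ->
  ev F (mu j) = 0.
Proof.
move=> FT; apply/eqP; apply: contraT => /(coefs_eval_neq0)[a /FT/T_over[mua muna]].
rewrite zmon_factor => /coefs_monM_neq0 amu; case/eqP: muna.
exact: lem_antisym.
Qed.

Lemma coefs_zmon_qdeg a : zmon z a (qdeg a) = \prod_i zred i 0%MM ^+ a i.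
Proof.
rewrite zmon_factor -{2}(addm0 (qdeg a)) coefs_monM mul1r.
rewrite -[LHS]/(const_coef (zmon zred a)) rmorph_prod; apply: eq_bigr => i _.
by rewrite rmorphXn.
Qed.

Lemma zred_var i : zred (lshift g i) 0%MM = 1.
Proof. by rewrite /= addm0 z_var coefs_mon eqxx. Qed.

Lemma coefs_zX_mu j : (z (rshift d j) ^+ nn j) (mu j) = zred (rshift d j) 0%MM ^+ nn j.
Proof.
rewrite {1}z_factor exprMn fps_monX -[mu j]addm0 coefs_monM mul1r.
by rewrite -[LHS]/(const_coef _) rmorphXn.
Qed.

(** The coefficient of the equation at [mu j] sees only the binomial: the initial coefficients form
    a point of the toric variety of the binomials. *)
Lemma zred_rel j :
  \prod_i zred i 0%MM ^+ ell j i = zred (rshift d j) 0%MM ^+ nn j.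
Proof.
have /eqP := congr1 (fun f : fps K d => f (mu j)) (system0 j).
rewrite eval_system !coefsD coefsN eval_T_mu // addr0 subr_eq0 coefs_zX_mu.
by rewrite -{1}qdeg_ell coefs_zmon_qdeg => /eqP.
Qed.

(** By [zred_rel], a vanishing coefficient forces one of a variable occurring in [ell j], hence of
    smaller index, to vanish as well. The descent would end at one of the first [d] variables, whose
    coefficient is 1. *)
Lemma zred0_neq0 i : zred i 0%MM != 0.
Proof.
case: (splitP i) => [l il|j ij].
  have -> : i = lshift g l by apply: ord_inj.
  by rewrite zred_var oner_neq0.
have -> : i = rshift d j by apply: ord_inj.
move: {2}(j : nat) (leqnn j) => m; elim: m j {i ij} => [|m IHm] j jm.
  all: apply/eqP => zj0; have /eqP := zred_rel j.
  all: rewrite zj0 expr0n (gtn_eqF (nn_gt0 j)) => /prodf_eq0[i _].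
  all: rewrite expf_eq0 lt0n => /andP[elli]; apply/negP.
  all: case: (splitP i) => [l il|k ik].
  1,3: by (have -> : i = lshift g l by apply: ord_inj); rewrite zred_var oner_neq0.
  all: have kj : (k < j)%N by rewrite ltnNge; apply: contra_neqN elli => jk;
    rewrite ell_lt // ik leq_add2l.
  - by move: (leq_trans kj jm).
have -> : i = rshift d k by apply: ord_inj.
by apply: IHm; rewrite -ltnS (leq_trans kj).
Qed.

Lemma eval_eulerE j k : ev (fps_deriv (rshift d k) (system j)) * z (rshift d k) =
  ev (Fps (fun a => system j a *+ a (rshift d k))).
Proof. by rewrite -coefs_eulerE rmorphM /= eval_var mulrC. Qed.

(** The value of U_{d+k} dH_j/dU_{d+k} along the branch, divided by X^{mu_j}; see [jac_factor]. *)
Definition jac_red j k : fps K d :=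
  Fps (fun a => ev (Fps (fun a => system j a *+ a (rshift d k))) (mu j + a)%MM).

Lemma eval_euler_system j k : ev (Fps (fun a => system j a *+ a (rshift d k))) =
  zmon z (ell j) *+ ell j (rshift d k) - z (rshift d j) ^+ nn j *+ ((j == k) * nn j)
  + ev (Fps (fun a => T j a *+ a (rshift d k))).
Proof.
have -> : Fps (fun a => system j a *+ a (rshift d k)) =
    fps_mon 1 (ell j) *+ ell j (rshift d k)
    - fps_mon 1 (U_(rshift d j) *+ nn j)%MM *+ ((j == k) * nn j)
    + Fps (fun a => T j a *+ a (rshift d k)) :> fps K (d + g).
  apply: fpsP => a; rewrite [LHS]/= !coefsD !coefsN !coefsMn !mulrnDl !mulNrn !coefs_mon.
  congr (_ - _ + _); first by case: eqP => [->|] //; rewrite !mul0rn.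
  case: eqP => [->|]; last by rewrite !mul0rn.
  by rewrite mulmnE mnm1E (inj_eq (@rshift_inj _ _)).
rewrite rmorphD rmorphB /= !raddfMn /= !eval_mon rmorph1 !mul1r.
by rewrite zmonUn.
Qed.

Lemma jac_factor j k : ev (fps_deriv (rshift d k) (system j)) * z (rshift d k) =
  fps_mon 1 (mu j) * jac_red j k.
Proof.
rewrite eval_eulerE; apply: fps_factor => a /coefs_eval_neq0[b].
rewrite zmon_factor => Fb /coefs_monM_neq0; apply: lepm_trans.
have {Fb} : system j b != 0 by apply: contraNneq Fb => /= ->; rewrite mul0rn.
rewrite /system !coefsD coefsN; have [|/T_over[]//] := eqVneq (T j b) 0.
move=> ->; rewrite addr0 !coefs_mon.
have [->|_] := eqVneq b (ell j); first by rewrite qdeg_ell lepm_refl.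
rewrite sub0r oppr_eq0; have [->|_] := eqVneq b _; last by rewrite mulr0n eqxx.
by rewrite qdegU lepm_refl.
Qed.

Lemma jac_red0 j k : jac_red j k 0%MM =
  zred (rshift d j) 0%MM ^+ nn j *+ ell j (rshift d k)
  - zred (rshift d j) 0%MM ^+ nn j *+ ((j == k) * nn j).
Proof.
rewrite -[LHS]/(ev (Fps (fun a => system j a *+ a (rshift d k))) (mu j + 0)%MM) addm0.
rewrite eval_euler_system !coefsD coefsN !coefsMn.
rewrite coefs_zX_mu -{1}qdeg_ell coefs_zmon_qdeg zred_rel eval_T_mu ?addr0 //.
by move=> a; apply: contraNneq => /= ->; rewrite mul0rn.
Qed.

(** At 0 the entries above the diagonal vanish, since [ell j] involves only earlier variables, and
    the diagonal entry is -n_j times a power of a nonzero initial coefficient; characteristic 0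
    keeps it nonzero. *)
Lemma det_jac_red0 : \det (\matrix_(j, k) jac_red j k) 0%MM != 0.
Proof.
rewrite -[X in X != _]/(const_coef _) -det_map_mx det_trig.
  apply/prodf_neq0 => j _; rewrite !mxE -[X in X != 0]/(jac_red j j 0%MM) jac_red0 eqxx mul1n.
  rewrite ell_lt // mulr0n sub0r oppr_eq0 -mulr_natr mulf_neq0 //.
    by rewrite expf_neq0 // zred0_neq0.
  by move/pcharf0P: charK => ->; rewrite -lt0n.
apply/is_trig_mxP => j k jk; rewrite !mxE -[LHS]/(jac_red j k 0%MM) jac_red0.
rewrite ell_lt ?leq_add2l ?(ltnW jk) // mulr0n sub0r.
by case: eqP jk => [->|]; rewrite ?ltnn // mul0n mulr0n oppr0.
Qed.

(* Multiplying the column of [U_{d+k}] by [z (rshift d k)] turns derivations into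
   Euler operators, which preserve the weights; only the binomials contribute to
   the lowest exponent, and they yield a triangular matrix. *)
Lemma det_jac_system :
  exists2 u : fps K d, u 0%MM != 0 &
    \det (\matrix_(j, k) ev (fps_deriv (rshift d k) (system j))) =
    fps_mon 1 (\sum_j q (rshift d j) *+ (nn j).-1)%MM * u.
Proof.
set D := \det _; set s := (\sum_j _)%MM.
have Drel : D * \prod_k z (rshift d k) =
    fps_mon 1 (\sum_j mu j)%MM * \det (\matrix_(j, k) jac_red j k).
  rewrite -fps_mon_prod.
  have -> : \prod_k z (rshift d k) = \det (diag_mx (\row_k z (rshift d k))).
    by rewrite det_diag; apply: eq_bigr => k _; rewrite mxE.
  have -> : \prod_j fps_mon 1 (mu j) = \det (diag_mx (\row_j fps_mon 1 (mu j))) :> fps K d.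
    by rewrite det_diag; apply: eq_bigr => k _; rewrite mxE.
  rewrite -!det_mulmx mul_mx_diag mul_diag_mx; congr (\det _).
  by apply/matrixP => j k; rewrite !mxE jac_factor.
have [V prodV] : exists V, \prod_k zred (rshift d k) * V = 1.
  apply: fps_invertible; rewrite -[X in X != _]/(const_coef _) rmorph_prod.
  by apply/prodf_neq0 => k _; apply: zred0_neq0.
have V0 : V 0%MM != 0.
  apply/eqP => V0; have /eqP := congr1 (fun f : fps K d => f 0%MM) prodV.
  by rewrite coefsM0 V0 mulr0 coefs1 eqxx eq_sym oner_eq0.
exists (\det (\matrix_(j, k) jac_red j k) * V).
  by rewrite coefsM0 mulf_neq0 // det_jac_red0.
have prodz : \prod_k z (rshift d k) =
    fps_mon 1 (\sum_k q (rshift d k))%MM * \prod_k zred (rshift d k).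
  by rewrite -fps_mon_prod -big_split; apply: eq_bigr => k _; rewrite {1}z_factor.
(* Dividing by the product of the [z (rshift d k)] removes one [q (rshift d j)] from each [mu j]:
   this is the origin of the exponents n_j - 1. *)
have sumE : (\sum_j mu j = s + \sum_k q (rshift d k))%MM.
  rewrite -big_split; apply: eq_bigr => j _ /=.
  by rewrite addmC -mulmS prednK.
have monE a b : fps_mon 1 (a + b)%MM = fps_mon 1 a * fps_mon 1 b :> fps K d.
  by rewrite fps_monM mul1r.
apply: (mulIf (fps_mon_neq0 K (\sum_k q (rshift d k))%MM)).
rewrite -[LHS]mulr1 -prodV mulrA -[D * _ * _]mulrA -prodz Drel sumE monE.
by ring.
Qed.

End OverweightSystem.

(** * Exponents and logarithmic forms *)

Section FractionalExponents.
Variables (d n : nat).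
Hypothesis n_gt0 : (0 < n)%N.
Implicit Types a b : 'X_{1..d}.
Local Notation expo := (@expo d n).

Lemma expo_inj : injective expo.
Proof.
move=> a b /rowP ab; apply/mnmP => i; have := ab i; rewrite !mxE.
have n0 : n%:R^-1 != 0 :> rat by rewrite invr_eq0 pnatr_eq0 -lt0n.
by move/(mulIf n0)/eqP; rewrite eqr_nat => /eqP.
Qed.

Lemma expo_preceq a b : preceq (expo a) (expo b) <-> (a <= b)%MM.
Proof.
have ninv : 0 < n%:R^-1 :> rat by rewrite invr_gt0 ltr0n.
split=> [ab|/mnm_lepP ab i]; last by rewrite !mxE ler_pM2r // ler_nat.
by apply/mnm_lepP => i; have := ab i; rewrite !mxE ler_pM2r // ler_nat.
Qed.

Lemma expo_prec a b : prec (expo a) (expo b) -> (a <= b)%MM /\ a != b.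
Proof. by case=> /expo_preceq ? ab; split=> //; apply: contraNneq ab => ->. Qed.

Lemma expoMn a j : expo (a *+ j)%MM = expo a *+ j.
Proof.
elim: j => [|j IHj]; first by rewrite mulm0n expo0.
by rewrite mulmS expoD IHj mulrS.
Qed.

Lemma expo_sum (I : finType) (F : I -> 'X_{1..d}) :
  expo (\sum_i F i)%MM = \sum_i expo (F i).
Proof. by apply: (big_morph expo (@expoD d n)); rewrite expo0. Qed.

Lemma expoU i : expo (U_(i) *+ n)%MM = delta_mx 0 i.
Proof.
apply/rowP => j; rewrite !mxE mulmnE mnm1E natrM eq_sym eqxx /=.
by rewrite mulfK // pnatr_eq0 -lt0n.
Qed.

Lemma Xmon_expo (R : realType) a : Xmon R n (expo a) = fps_mon 1 a.
Proof. by apply: fpsP => b; rewrite /= (inj_eq expo_inj). Qed.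

(** The positive and negative parts of a - b are the truncated differences a - b and b - a, and b +
    (a - b) = a + (b - a). An identity of fractions is thus tested on series. *)
Lemma Xfrac_expo (R : realType) a b (x y : fps R[i] d) :
    fps_mon 1 b * y = fps_mon 1 a * x ->
  Xfrac R n (expo a - expo b) * tofrac x = tofrac y.
Proof.
move=> bay.
have maxE a' b' : map_mx (Num.max 0) (expo a' - expo b') = expo (a' - b')%MM.
  apply/rowP => i; rewrite !mxE -mulrBl mnmBE.
  have [le_ba|lt_ab] := leqP (b' i) (a' i).
    by rewrite -natrB // max_r // mulr_ge0 ?invr_ge0 ?ler0n.
  rewrite (_ : (a' i - b' i)%N = 0%N) ?mul0r; last by apply/eqP/ltnW.
  rewrite max_l // mulr_le0_ge0 ?invr_ge0 ?ler0n // subr_le0 ler_nat ltnW //.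
rewrite /Xfrac opprB !maxE !Xmon_expo.
have mon0 m : tofrac (fps_mon 1 m : fps R[i] d) != 0.
  by rewrite tofrac_eq0 fps_mon_neq0.
rewrite mulrAC; apply: (canLR (mulfK (mon0 _))); rewrite -!tofracM; congr tofrac.
apply: (mulfI (fps_mon_neq0 _ b)); rewrite [in RHS]mulrA bay mulrA fps_monM.
rewrite mulrAC fps_monM; congr (fps_mon _ _ * x).
by apply/mnmP => i; rewrite !mnmDE !mnmBE; lia.
Qed.

End FractionalExponents.

Section CharacteristicExponents.
Variables (R : realType) (d n g : nat) (f : {poly fps R[i] d}).
Variable lam : g.-tuple 'rV[rat]_d.
Hypothesis qo_f : qo_hypersurface n lam f.

(** At X = 0 a Weierstrass polynomial of degree n becomes Y^n. *)
Lemma qo_root0 z : root f z -> z 0%MM = 0.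
Proof.
case: qo_f => -[sf [/monicP f1 _ f0] _ _] _; rewrite sf /= in f0.
move=> /rootP/(congr1 (@const_coef _ d)); rewrite horner_coef sf big_ord_recr rmorphD /=.
rewrite [f`_n](_ : _ = 1) ?mul1r; last by rewrite -f1 /lead_coef sf.
rewrite rmorph_sum big1 => [|i _]; last by rewrite rmorphM /= [const_coef f`_i]f0 // mul0r.
rewrite add0r rmorphXn => /eqP; rewrite expf_eq0 => /andP[_ /eqP].
by [].
Qed.

Lemma qo_degree_gt0 : (0 < n)%N.
Proof.
case: qo_f => -[sf [/monicP f1 _ _] [_ fU _] _] _; rewrite lt0n; apply/eqP => n0.
case: fU; have -> : f = 1.
  have f01 : f`_0 = 1 by rewrite -f1 /lead_coef sf n0.
  by rewrite [f]size1_polyC ?sf ?n0 // f01.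
have CX1 : CXY n (1 : {poly fps R[i] d}).
  have i0 : @int_lattice d 0 by exists 0 => //; rewrite map_mx0.
  have iB x y : int_lattice x -> int_lattice y -> @int_lattice d (x - y).
    by move=> [a _ <-] [b _ <-]; exists (a - b) => //; rewrite map_mxB.
  have hCX := pser_subring R n i0 iB.
  move=> i; rewrite coef1; case: (i == 0%N); first by case: hCX.
  exact: (subring_set0 hCX).
by split=> //; exists 1; rewrite ?mulr1.
Qed.

(** [Xmon] is 0 at an exponent outside the orthant of (1/n) Z^d, which would make the two roots
    equal. The exponent is nonzero because both roots vanish at 0 while the unit does not. *)
Lemma char_exponent_expo j : (j < g)%N -> exists2 a, a != 0%MM & lam`_j = expo n a.
Proof.
move=> jg; case: (qo_f) => _ [charE _].
have /charE[z [z' [u [[_ _ rz rz'] [zz' [_ [v _ uv]] zE]]]]] : lam`_j \in lam.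
  by rewrite mem_nth // size_tuple.
have {}rz := qo_root0 rz; have {}rz' := qo_root0 rz'.
have u0 : u 0%MM != 0.
  apply/eqP => u0; have /eqP := congr1 (@const_coef _ d) uv.
  by rewrite rmorphM rmorph1 /= [const_coef u]u0 mul0r eq_sym oner_eq0.
have [a /eqP aE] : exists a, expo n a == lam`_j.
  apply: contrapT => no; case/eqP: zz'; apply/eqP; rewrite -subr_eq0 zE mulf_eq0.
  apply/orP; left; apply/eqP/fpsP => a /=; case: eqP => // aE.
  by case: no; exists a; rewrite aE.
exists a => //; apply/eqP => a0; have /eqP := congr1 (@const_coef _ d) zE.
rewrite rmorphB /= [const_coef z]rz [const_coef z']rz' subrr rmorphM /= {1}/const_coef /=.
by rewrite -aE a0 eqxx mul1r eq_sym; apply/negP.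
Qed.

End CharacteristicExponents.

Lemma eulerC_mon (K : fieldType) d (chi : 'X_{1..d} -> K) (c : K) a :
  euler chi (fps_mon c a) = fps_mon c a * fpsC d (chi a).
Proof.
rewrite fps_monM addm0; apply: fpsP => b /=.
by case: (eqVneq b a) => [->|_]; rewrite ?mulr1n // !mulr0n mul0r.
Qed.

Section LatticeExponents.
Variables (d n g : nat) (lam : g.-tuple 'rV[rat]_d) (nn : g.-tuple nat).
Variable al : nat -> 'X_{1..d}.
Hypothesis n_gt0 : (0 < n)%N.
Hypothesis al_neq0 : forall j, (j < g)%N -> al j != 0%MM.
Hypothesis lamE : forall j, (j < g)%N -> lam`_j = expo n (al j).
Hypothesis lam_prec : forall i j, (i < j < g)%N -> prec lam`_i lam`_j.
Hypothesis nn_gt0 : forall j : 'I_g, (0 < nth 0%N nn j)%N.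

(** This is n times [lbar]; the truncated subtraction is exact because the [al j] increase
    ([al_lt]). *)
Fixpoint lbar_exp j : 'X_{1..d} :=
  if j is i.+1 then (lbar_exp i *+ nth 0%N nn i + (al i.+1 - al i))%MM else al 0.

Lemma al_lt j : (j.+1 < g)%N -> (al j <= al j.+1)%MM /\ al j != al j.+1.
Proof.
move=> jg; apply: (@expo_prec d n n_gt0); rewrite -!lamE ?(ltnW jg) //.
by apply: lam_prec; rewrite ltnSn.
Qed.

Lemma lbarE j : (j < g)%N -> lbar lam nn j = expo n (lbar_exp j).
Proof.
elim: j => [|j IHj] jg /=; first exact: lamE.
rewrite IHj ?(ltnW jg) // expoD expoMn; congr (_ + _).
by rewrite !lamE ?(ltnW jg) // -{1}(submK (proj1 (al_lt jg))) expoD addrK.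
Qed.

Lemma lbar_exp_neq0 j : (j < g)%N -> lbar_exp j != 0%MM.
Proof.
case: j => [|j] jg /=; first exact: al_neq0.
have [le_al ne_al] := al_lt jg; apply: contraNneq ne_al => /eqP.
rewrite mnmD_eq0 => /andP[_ /eqP al0].
by rewrite -(submK le_al) al0 add0m.
Qed.

Definition gam_exp (i : 'I_(d + g)) : 'X_{1..d} :=
  match split i with inl i => (U_(i) *+ n)%MM | inr j => lbar_exp j end.

Lemma gam_expE i : gam lam nn i = expo n (gam_exp i).
Proof.
by rewrite /gam /gam_exp; case: (split i) => j; rewrite ?expoU // lbarE.
Qed.

Lemma gam_exp_rshift (j : 'I_g) : gam_exp (rshift d j) = lbar_exp j.
Proof. by rewrite /gam_exp (unsplitK (inr j)). Qed.

Lemma gam_exp_lshift (i : 'I_d) : gam_exp (lshift g i) = (U_(i) *+ n)%MM.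
Proof. by rewrite /gam_exp (unsplitK (inl i)). Qed.

Lemma gam_exp_neq0 i : gam_exp i != 0%MM.
Proof.
rewrite /gam_exp; case: (split i) => j; last exact: lbar_exp_neq0.
by rewrite -mdeg_eq0 mdegMn mdeg1 mul1n -lt0n.
Qed.

Lemma psiE a : psi lam nn a = expo n (qdeg gam_exp a).
Proof.
rewrite /psi /qdeg expo_sum; apply: eq_bigr => i _.
by rewrite gam_expE expoMn.
Qed.

Lemma muE (j : 'I_g) : lbar lam nn j *+ nth 0%N nn j =
  expo n (mu gam_exp (fun j : 'I_g => nth 0%N nn j) j).
Proof. by rewrite lbarE // /mu gam_exp_rshift expoMn. Qed.

(** The difference of these weights is that of two consecutive characteristic exponents. Hence the
    linear term c_j U_{d+j+1} is also overweight. *)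
Lemma mu_lt_next (j k : 'I_g) : k = j.+1 :> nat ->
  let m := mu gam_exp (fun j : 'I_g => nth 0%N nn j) j in
  (m <= gam_exp (rshift d k))%MM /\ m != gam_exp (rshift d k).
Proof.
move=> kj; rewrite /= /mu !gam_exp_rshift kj /=; split; first exact: lem_addr.
have jg : (j.+1 < g)%N by rewrite -kj.
have [le_al ne_al] := al_lt jg; apply: contraNneq ne_al => eq_m.
rewrite -(submK le_al); suff -> : (al j.+1 - al j)%MM = 0%MM by rewrite add0m.
by apply/mnmP => i; have /mnmP/(_ i) := eq_m; rewrite mnmDE mnm0E; lia.
Qed.

Lemma gamma0E : gamma0 g lam nn =
  expo n (\sum_(j < g) gam_exp (rshift d j) *+ (nth 0%N nn j).-1)%MM
  - expo n (\sum_(i < d) U_(i) *+ n)%MM.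
Proof.
rewrite /gamma0 !expo_sum; congr (_ - _); apply: eq_bigr => i _.
  by rewrite gam_exp_rshift expoMn lbarE.
by rewrite expoU.
Qed.

End LatticeExponents.

Section LogarithmicForms.
Variables (R : realType) (d g n : nat) (L : set 'rV[rat]_d) (B : 'M[rat]_d).
Local Notation C := R[i].
Hypotheses (L0 : L 0) (LB : forall x y, L x -> L y -> L (x - y)).
Variables (zeta : 'I_g -> fps C d).
Local Notation z := (coords n zeta).
Hypothesis z0 : forall i, z i 0%MM = 0.
Hypothesis zL : forall i, pser n L (z i).

Definition log_weight (k : 'I_d) (a : 'X_{1..d}) : C :=
  ratr ((expo n a *m invmx B) 0 k).

Lemma log_weightD k a b : log_weight k (a + b)%MM = log_weight k a + log_weight k b.
Proof. by rewrite /log_weight expoD mulmxDl mxE rmorphD. Qed.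

Lemma log_diffE phi k : log_diff n B phi 0 k = euler (log_weight k) phi.
Proof. by rewrite mxE. Qed.

Definition log_matrix : 'M[fps C d]_(d + g, d) := \matrix_(i, k) log_diff n B (z i) 0 k.

Lemma eval_pser F : convergent F -> pser n L (fps_eval F z).
Proof. by apply: pser_eval. Qed.

(** By the chain rule the differential of F(z) is a combination of the rows of the coordinates, with
    the partial derivatives of F at z as coefficients; these converge, so they lie in the ring of
    the normalization. *)
Lemma log_forms_span w : log_forms n B (OS n zeta) w ->
  exists2 p : 'rV_(d + g), forall i, pser n L (p 0 i) & w = p *m log_matrix.
Proof.
have hS := pser_subring R n L0 LB.
case=> m [a [phi [OSa ->]]].
have /choice[F FE] l : exists F : fps C (d + g), convergent F /\ fps_eval F z = phi l.
  by case: (OSa l) => _ [F Fc <-]; exists F.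
have aL l : pser n L (a l) by case: (OSa l) => -[G Gc <-] _; apply: eval_pser.
exists (\row_i \sum_l a l * evalz z0 (fps_deriv i (F l))).
  move=> i; rewrite mxE; apply: (subring_set_sum hS) => l _.
  case: hS => _ _; apply=> //; apply: eval_pser; apply: convergent_deriv.
  by case: (FE l).
apply/rowP => k; rewrite summxE mxE.
under [RHS]eq_bigr do rewrite !mxE mulr_suml.
rewrite exchange_big; apply: eq_bigr => l _; rewrite mxE log_diffE.
case: (FE l) => _ <-; rewrite (chain_rule z0 (log_weightD k)) mulr_sumr.
by apply: eq_bigr => i _; rewrite mulrA.
Qed.

Hypothesis n_gt0 : (0 < n)%N.

Lemma coords_var (i : 'I_d) : z (lshift g i) = fps_mon 1 (U_(i) *+ n)%MM.
Proof. by rewrite /coords (unsplitK (inl i)) -(expoU n_gt0) Xmon_expo. Qed.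

(** The row of U_i is X_i times a constant row, the coordinates of e_i with respect to [B]. *)
Lemma det_log_matrix : exists2 c : fps C d, pser n L c &
  \det (usubmx log_matrix) = fps_mon 1 (\sum_i U_(i) *+ n)%MM * c.
Proof.
pose M : 'M[C]_d := \matrix_(i, k) log_weight k (U_(i) *+ n)%MM.
exists (fpsC d (\det M)); first by apply: pser_mon; rewrite expo0.
rewrite -det_map_mx -fps_mon_prod.
have -> : \prod_i fps_mon 1 (U_(i) *+ n)%MM =
    \det (diag_mx (\row_i fps_mon 1 (U_(i) *+ n)%MM)) :> fps C d.
  by rewrite det_diag; apply: eq_bigr => i _; rewrite mxE.
rewrite -det_mulmx mul_diag_mx; congr (\det _); apply/matrixP => i k.
by rewrite !mxE coords_var -[LHS]/(euler (log_weight k) _) eulerC_mon.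
Qed.

End LogarithmicForms.

(** * The inclusion of ideals for a fibre of the deformation *)

Section Inclusion.
Variables (R : realType) (d n g : nat) (f : {poly fps R[i] d}).
Variables (lam : g.-tuple 'rV[rat]_d) (nn : g.-tuple nat).
Variable ell : 'I_g -> 'X_{1..d + g}.
Variables (c1 : 'I_g -> R[i]) (c : 'I_g -> 'X_{1..d + g} -> R[i]).
Variables (p : 'rV[rat]_d -> R[i]) (zeta : 'I_g -> fps R[i] d) (B : 'M[rat]_d).
Local Notation C := R[i].
Local Notation L := (lattice lam g).
Local Notation H := (deform lam nn ell c1 c p).
Local Notation z := (coords n zeta).

Hypothesis qo_f : qo_hypersurface n lam f.
Hypothesis nn_index : forall j : 'I_g,
  is_index (lattice lam j.+1) (lattice lam j) (nth 0%N nn j).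
Hypothesis ellP : forall j : 'I_g, semigroup_relation lam nn j (ell j).
Hypothesis cP : overweight lam nn c1 c.
Hypothesis H_conv : forall j, convergent (H j).
Hypothesis zetaP : parametrization n lam H zeta.
Hypothesis LP : lattice_basis L B.

Let n_gt0 : (0 < n)%N := qo_degree_gt0 qo_f.

Lemma latticeB x y : L x -> L y -> L (x - y).
Proof.
case: LP => _ LE /LE[a ->] /LE[b ->]; apply/LE; exists (a - b).
by rewrite map_mxB mulmxBl.
Qed.

Lemma lattice0_mem j : lattice lam j 0.
Proof.
elim: j => [|j IHj]; first by exists 0 => //; rewrite map_mx0.
by exists 0, 0; split=> //; rewrite mulr0z addr0.
Qed.

Lemma lattice_expoU m i : lattice lam m (expo n (U_(i) *+ n)%MM).
Proof.
rewrite expoU //; elim: m => [|m IHm].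
  by exists (delta_mx 0 i) => //; rewrite map_delta_mx.
by exists (delta_mx 0 i), 0; rewrite mulr0z addr0.
Qed.

Lemma lattice_lam m j : (j < m)%N -> lattice lam m lam`_j.
Proof.
elim: m => [//|m IHm]; rewrite ltnS leq_eqVlt => /orP[/eqP ->|/IHm Lj].
  exists 0, 1; split; first exact: lattice0_mem.
  by rewrite mulr1z add0r.
by exists lam`_j, 0; rewrite mulr0z addr0.
Qed.

(** The coset of 0 has a representative, so the index set is inhabited. *)
Lemma index_gt0 (j : 'I_g) : (0 < nth 0%N nn j)%N.
Proof.
by case: (nn_index j) => r [_ /(_ 0 (lattice0_mem _))[[i ilt] _]]; apply: leq_ltn_trans ilt.
Qed.

Let nu (j : 'I_g) : nat := nth 0%N nn j.

(* The part of [H j] of weight greater than that of the binomial. *)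
Let T (j : 'I_g) : fps C (d + g) :=
  \sum_(k < g | k == j.+1 :> nat)
     fps_mon (c1 j * p (lbar lam nn j.+1 - lbar lam nn j *+ nth 0%N nn j)) U_(rshift d k)%MM
  + Fps (fun a => c j a * p (psi lam nn a - lbar lam nn j *+ nth 0%N nn j)).

Lemma deform_system j : H j = system nu ell T j.
Proof. by rewrite /deform /system /T addrA. Qed.

Lemma coords_pser i : pser n L (z i).
Proof.
rewrite /coords; case: (split i) => j; last by case: zetaP => /(_ j)[].
by rewrite -(expoU n_gt0) Xmon_expo //; apply: pser_mon; apply: lattice_expoU.
Qed.

Lemma coords0 i : z i 0%MM = 0.
Proof.
rewrite /coords; case: (split i) => j; last by case: zetaP => /(_ j)[].
rewrite -(expoU n_gt0) Xmon_expo // coefs_mon.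
by rewrite eq_sym -mdeg_eq0 mdegMn mdeg1 mul1n gtn_eqF.
Qed.

Local Notation ev := (evalz coords0).

Lemma det_jac_deform :
  exists (s : 'X_{1..d}) (u : fps C d), [/\
    gamma0 g lam nn = expo n s - expo n (\sum_(i < d) U_(i) *+ n)%MM,
    L (expo n s), u 0%MM != 0 &
    \det (\matrix_(j, k) ev (fps_deriv (rshift d k) (H j))) = fps_mon 1 s * u].
Proof.
have /choice[al alE] j : exists a, (j < g)%N -> a != 0%MM /\ lam`_j = expo n a.
  have [jg|] := ltnP j g; last by exists 0%MM.
  by have [a a0 aE] := char_exponent_expo qo_f jg; exists a.
have al_neq0 j : (j < g)%N -> al j != 0%MM by case/alE.
have lamE j : (j < g)%N -> lam`_j = expo n (al j) by case/alE.
have lam_prec : forall i j, (i < j < g)%N -> prec lam`_i lam`_j by case: qo_f => _ [].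
pose q := @gam_exp d n g nn al.
have qE i : gam lam nn i = expo n (q i) by apply: gam_expE.
have lbL (j : 'I_g) : L (lbar lam nn j).
  have latticeD := subgroupD (lattice0_mem g) latticeB.
  case: j => j /=; elim: j => [|j IHj] jg /=; first exact: lattice_lam.
  apply: latticeD; last by apply: latticeB; apply: lattice_lam => //; apply: ltnW.
  by apply: subgroupMn; [exact: lattice0_mem | exact: latticeB | exact/IHj/ltnW].
exists (\sum_j q (rshift d j) *+ (nu j).-1)%MM.
have muE' := muE nn n_gt0 lamE lam_prec.
have psiE' := psiE nn n_gt0 lamE lam_prec.
have [||||||||u u0 uE] := @det_jac_system C d g z coords0 q nu ell T.
- exact: pchar_num.
- by move=> i; rewrite /q gam_exp_lshift coords_var.
- exact: (gam_exp_neq0 nn n_gt0 al_neq0 lamE lam_prec).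
- exact: index_gt0.
- by move=> j i; case: (ellP j) => + _ _; apply.
- by move=> j; case: (ellP j) => _ _; rewrite muE' psiE' => /(expo_inj n_gt0) ->.
(* A monomial of [T j] with [c j a] nonzero is overweight by hypothesis; otherwise its coefficient
   comes from the linear term, and [mu_lt_next] applies. *)
- move=> j a Ta; have [cja0|/(proj2 cP j a)[_]] := eqVneq (c j a) 0; last first.
    by rewrite muE' psiE' => /(expo_prec n_gt0).
  have [k kj ->] : exists2 k : 'I_g, k = j.+1 :> nat & a = U_(rshift d k)%MM.
    apply: contrapT => no; case/eqP: Ta; rewrite coefsD coefs_sum big1 /= => [|k /eqP kj].
      by rewrite cja0 mul0r addr0.
    by case: eqVneq => // ak; case: no; exists k.
  rewrite -[U_(_)%MM]mulm1n qdegU mulm1n; exact: (mu_lt_next nn n_gt0 lamE lam_prec kj).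
- move=> j; rewrite -deform_system; case: zetaP => _ + _; exact.
exists u; split.
- exact: (gamma0E nn n_gt0 lamE lam_prec).
- rewrite expo_sum; apply: (big_ind L) => [|x y|j _]; first exact: lattice0_mem.
    by apply: subgroupD; [exact: lattice0_mem | exact: latticeB].
  rewrite expoMn -qE /gam (unsplitK (inr j)).
  by apply: subgroupMn; [exact: lattice0_mem | exact: latticeB | exact: lbL].
- exact: u0.
by rewrite -uE; congr (\det _); apply/matrixP => j k; rewrite !mxE deform_system.
Qed.

Lemma OZ_subring : subring_set (OZ n lam : set (fps C d)).
Proof. exact: (pser_subring R n (lattice0_mem g) latticeB). Qed.

Lemma jacobian_ideal : ideal_set (OZ n lam) (jacobian n lam H zeta).
Proof. exact: ideal_gen_ideal OZ_subring _. Qed.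

Lemma eval_OZ F : convergent F -> OZ n lam (ev F).
Proof.
apply: (pser_eval (lattice0_mem g) latticeB) => i; split; last exact: coords0.
exact: coords_pser.
Qed.

Lemma det_jacobian (P : 'M[fps C d]_(d, d + g)) : (forall i k, OZ n lam (P i k)) ->
  jacobian n lam H zeta (\det (col_mx P (\matrix_(j, i) ev (fps_deriv i (H j))))).
Proof.
move=> PZ; apply: (laplace_ideal OZ_subring jacobian_ideal) => // s smono.
apply: (ideal_gen_mem OZ_subring).
exists (\det (\matrix_(j, k) fps_deriv (s k) (H j))); first by exists s.
rewrite -[LHS]/(ev _) -det_map_mx; congr (\det _).
by apply/matrixP => j k; rewrite !mxE.
Qed.

Lemma jacobian_log_matrix :
  (\matrix_(j, i) ev (fps_deriv i (H j))) *m log_matrix n B zeta = 0.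
Proof.
apply/matrixP => j k; rewrite !mxE; under eq_bigr do rewrite !mxE.
have := chain_rule coords0 (log_weightD R n B k) (H j).
by case: zetaP => _ /(_ j) Hj _; rewrite {1}/evalz Hj raddf0 => <-.
Qed.

Lemma log_jacobian_sub x : log_jacobian n B (OZ n lam) (OS n zeta) x ->
  exists2 y, jacobian n lam H zeta y &
    Xfrac R n (gamma0 g lam nn) * tofrac x = tofrac y.
Proof.
have [hZ1 hZB hZM] := OZ_subring.
have [s [u [-> Ls u0 uE]]] := det_jac_deform.
have [c' c'L c'E] := det_log_matrix B (lattice0_mem g) zeta n_gt0.
set one := (\sum_i _)%MM in c'E *.
(* [u] is known only through the product X^s u, a determinant over O_Z; shifting the coefficients
   back by [s], whose exponent is in M, keeps it in O_Z. *)
have uL : OZ n lam u.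
  have -> : u = Fps (fun a => (fps_mon 1 s * u) (s + a)%MM).
    apply: fpsP => a; rewrite -[RHS]/((fps_mon 1 s * u) (s + a)%MM).
    by rewrite coefs_monM mul1r.
  apply: (pser_shift latticeB Ls); rewrite -uE.
  apply: (subring_set_det OZ_subring) => j k; rewrite mxE.
  by apply: eval_OZ; apply: convergent_deriv; apply: H_conv.
have [v vL uv] := pser_inv (lattice0_mem g) latticeB uL u0.
have detA A : (forall k, log_forms n B (OS n zeta) (row k A)) ->
    exists2 y, jacobian n lam H zeta y & fps_mon 1 one * y = fps_mon 1 s * \det A.
  move=> Alog.
  have /choice[P PE] k : exists r : 'rV_(d + g),
      (forall i, OZ n lam (r 0 i)) /\ row k A = r *m log_matrix n B zeta.
    have [r rL rE] :=
      log_forms_span (lattice0_mem g) latticeB coords0 coords_pser (Alog k).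
    by exists r.
  pose PM := \matrix_(k, i) P k 0 i.
  have AE : A = PM *m log_matrix n B zeta.
    apply/row_matrixP => k; rewrite (proj2 (PE k)) row_mul; congr (_ *m _).
    by apply/rowP => i; rewrite !mxE.
  have PML k i : OZ n lam (PM k i) by rewrite mxE; case: (PE k).
  have [_ _ JM] := jacobian_ideal.
  (* The relation det [P; N] X^{one} c' = det A X^s u, multiplied by v = u^{-1}, exhibits this
     multiple. *)
  exists (c' * v * \det (col_mx PM (\matrix_(j, i) ev (fps_deriv i (H j))))).
    by apply: (JM); [apply: hZM | apply: det_jacobian].
  have := det_kernel_proportional PM jacobian_log_matrix.
  rewrite c'E -AE (_ : rsubmx _ = \matrix_(j, k) ev (fps_deriv (rshift d k) (H j))).
    rewrite uE => rel; transitivity (v * (\det A * (fps_mon 1 s * u))).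
      by rewrite -rel; ring.
    by transitivity (fps_mon 1 s * \det A * (u * v)); [ring | rewrite uv mulr1].
  by apply/matrixP => j k; rewrite !mxE.
case=> m [a [D [aD ->]]].
have /choice[y yE] i : exists y, jacobian n lam H zeta y /\
    fps_mon 1 one * y = fps_mon 1 s * D i.
  by case: (aD i) => _ [A /detA[y Jy yA] <-]; exists y.
exists (\sum_i a i * y i).
  apply: (ideal_set_sum _ jacobian_ideal) => i _; have [_ _ JM] := jacobian_ideal.
  by apply: (JM); [case: (aD i) | case: (yE i)].
(* Denominators are cleared: it remains to compare X^{one} y with X^s x, term by term. *)
apply: (Xfrac_expo n_gt0); rewrite !mulr_sumr; apply: eq_bigr => i _.
by rewrite !(mulrCA _ (a i)) (proj2 (yE i)).
Qed.

End Inclusion.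

Local Open Scope classical_set_scope.

Theorem theorem4p13 (R : realType) (d n g : nat) (f : {poly fps R[i] d})
    (lam : g.-tuple 'rV[rat]_d) (nn : g.-tuple nat)
    (ell : 'I_g -> 'X_{1..d + g})
    (c1 : 'I_g -> R[i]) (c : 'I_g -> 'X_{1..d + g} -> R[i])
    (p : 'rV[rat]_d -> R[i]) (zeta : 'I_g -> fps R[i] d) (B : 'M[rat]_d) :
  (0 < d)%N ->
  qo_hypersurface n lam f ->
  (forall j : 'I_g, is_index (lattice lam j.+1) (lattice lam j) (nth 0%N nn j)) ->
  (forall j : 'I_g, semigroup_relation lam nn j (ell j)) ->
  overweight lam nn c1 c ->
  torus_point (lattice lam g) p ->
  (forall j : 'I_g, convergent (deform lam nn ell c1 c p j)) ->
  parametrization n lam (deform lam nn ell c1 c p) zeta ->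
  lattice_basis (lattice lam g) B ->
  [set Xfrac R n (gamma0 g lam nn) * tofrac x
     | x in log_jacobian n B (OZ n lam) (OS n zeta)]
  `<=` [set tofrac x | x in jacobian n lam (deform lam nn ell c1 c p) zeta].
Proof.
move=> _ qo_f nn_index ellP cP _ H_conv zetaP LP _ [x xlog <-].
have [y Jy yE] := log_jacobian_sub qo_f nn_index ellP cP H_conv zetaP LP xlog.
by exists y.
Qed.
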